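(* The following identity holds: $$\int_{0}^{\infty}\frac{\operatorname{Re}\!\left(\zeta\!\left(\frac12+iv\right)\right)}{\cosh(\pi v)}\,dv=\gamma-1.$$
   Context: $\zeta$ is the Riemann zeta function and $\gamma$ is the Euler–Mascheroni constant. *)

(* Defs.v *)
From Stdlib Require Import Reals.
From Coquelicot Require Import Coquelicot.
Open Scope R_scope.

Definition Cexp (z : C) : C :=
  (exp (Re z) * cos (Im z), exp (Re z) * sin (Im z)).

(* The principal value of x^s; only meaningful for 0 < x. *)
Definition Rpow_C (x : R) (s : C) : C := Cexp (s * RtoC (ln x))%C.

Definition analytic_at (f : C -> C) (s : C) : Prop :=
  exists (a : nat -> C) (r : R), 0 < r /\
    forall z : C, Cmod (z - s)%C < r ->
      @is_pseries C_AbsRing C_NormedModule a (z - s)%C (f z).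

(* The analytic continuation to C \ {1} of the Dirichlet series
   sum_{n >= 1} 1 / n^s.  Since C \ {1} is connected, this determines zeta
   uniquely away from s = 1; the value at the pole is left arbitrary. *)
Definition is_Riemann_zeta (zeta : C -> C) : Prop :=
  (forall s : C, 1 < Re s ->
     @is_series C_AbsRing C_NormedModule
       (fun n : nat => (/ Rpow_C (INR (S n)) s)%C) (zeta s)) /\
  (forall s : C, s <> RtoC 1 -> analytic_at zeta s).

Definition Euler_gamma : R :=
  real (Lim_seq (fun n : nat => sum_n_m (fun k : nat => / INR k) 1 n - ln (INR n))).

(* Main.v *)
Require Import Defs.
From Stdlib Require Import Reals.
From Coquelicot Require Import Coquelicot.
From Stdlib Require Import Lra Lia Classical Factorial.
Open Scope R_scope.

(** On the critical line [zeta(s)] is the limit of [sum_(n <= N) n^-s - N^(1-s) / (1-s)], uniformly up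
    to [O((1 + |v|) / sqrt N)].  Pairing with [1 / cosh (PI v)] can therefore be done termwise, and
    [int_0^oo cos (v t) / cosh (PI v) dv = 1 / (2 cosh (t / 2))] turns [n^-s] into [1 / (n + 1)] and
    [N^(1-s) / (1-s) = int_0^N x^-s dx] into [ln (N + 1)].  What remains is
    [sum_(n <= N) 1 / (n + 1) - ln (N + 1)], which tends to [gamma - 1].

    The cosine transform comes from expanding [1 / cosh] geometrically; the resulting partial fraction
    series is summed with the Dirichlet kernel and normalised by Leibniz' series.  The formula for
    [zeta] holds for [Re s > 1] and is carried to the critical line along each horizontal line
    [Im s = v <> 0], where only real analyticity in one real variable is involved. *)

(** * The cosine transform of the hyperbolic secant *)

(** The order of the limits shapes the estimates. For fixed N the termwise pairing over [0, V] is
    exact up to exp (- PI V) times a constant that grows with N, while replacing zeta by its N-th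
    approximation costs at most a multiple of 1 / sqrt N, whatever V is. So V must go to infinity
    first and N second. For this reason each transform is stated as a bound on the integral over
    [0, V] with an explicit error, and no infinite sum is ever exchanged with an integral. The power
    term is treated as a function of t = ln N: its t-derivative is again a cosine transform, and its
    decay as t tends to -infinity fixes the constant of integration, which yields ln (1 + exp t).
    Complex identities are split into real and imaginary parts and multiplied by 1 - s, so that in
    the real part sigma only polynomial coefficients occur. *)

(* Coquelicot's lemmas leave equations typed in a structure whose carrier is [R]. *)
Ltac ring_in_R := match goal with |- ?x = ?y => change (@eq R x y); ring end.

(** Both [G - F] and [G + F] are nondecreasing. It replaces most integral estimates below: a
    majorant of the derivative with an explicit primitive bounds the increment. *)
Lemma increment_bound (F f G g : R -> R) (a b : R) :
  a <= b ->
  (forall x, a <= x <= b -> is_derive F x (f x)) ->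
  (forall x, a <= x <= b -> is_derive G x (g x)) ->
  (forall x, a <= x <= b -> Rabs (f x) <= g x) ->
  Rabs (F b - F a) <= G b - G a.
Proof.
  intros Hab HF HG Hfg.
  assert (mono : forall H h : R -> R,
    (forall x, a <= x <= b -> is_derive H x (h x)) ->
    (forall x, a <= x <= b -> 0 <= h x) -> H a <= H b).
  { intros H h HH Hh.
    destruct (MVT_gen H a b h) as [c [Hc E]];
      rewrite ?(Rmin_left _ _ Hab), ?(Rmax_right _ _ Hab) in *.
    - intros x Hx; apply HH; lra.
    - intros x Hx; apply continuity_pt_filterlim.
      apply (ex_derive_continuous H); exists (h x); auto.
    - specialize (Hh c Hc). nra. }
  assert (H1 := mono (fun x => G x - F x) (fun x => g x - f x)).
  assert (H2 := mono (fun x => G x + F x) (fun x => g x + f x)).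
  apply Rabs_le; split.
  - cut (G a + F a <= G b + F b); [lra|]. apply H2; intros x Hx.
    + apply (is_derive_plus G F); auto.
    + specialize (Hfg x Hx); apply Rabs_le_between in Hfg; lra.
  - cut (G a - F a <= G b - F b); [lra|]. apply H1; intros x Hx.
    + apply (is_derive_minus G F); auto.
    + specialize (Hfg x Hx); apply Rabs_le_between in Hfg; lra.
Qed.

Lemma ex_RInt_everywhere_continuous (f : R -> R) (a b : R) :
  (forall x, continuous f x) -> ex_RInt f a b.
Proof. intros Hf; apply (@ex_RInt_continuous R_CompleteNormedModule); auto. Qed.

Lemma is_derive_RInt_upper (f : R -> R) (V : R) :
  (forall x, continuous f x) -> is_derive (fun W => RInt f 0 W) V (f V).
Proof.
  intros Hf; apply (is_derive_RInt f _ 0 V); [|apply Hf].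
  exists posreal_one; intros W _.
  apply (@RInt_correct R_CompleteNormedModule).
  now apply ex_RInt_everywhere_continuous.
Qed.

Lemma exp_le (x y : R) : x <= y -> exp x <= exp y.
Proof. intros [H| ->]; [left; now apply exp_increasing|right; easy]. Qed.

Lemma cosh_pos (x : R) : 0 < cosh x.
Proof. unfold cosh; pose proof (exp_pos x); pose proof (exp_pos (- x)); lra. Qed.

Lemma inv_cosh_le (x : R) : / cosh x <= 2 * exp (- x).
Proof.
  apply Rmult_le_reg_l with (cosh x); [apply cosh_pos|].
  rewrite Rinv_r by (apply Rgt_not_eq, cosh_pos).
  assert (E : exp x * exp (- x) = 1) by (rewrite <- exp_plus, Rplus_opp_r; apply exp_0).
  unfold cosh. pose proof (exp_pos x); pose proof (exp_pos (- x)); nra.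
Qed.

(** The exponents in 1 / cosh (PI v) = 2 sum_k (-1)^k exp (- (2 k + 1) PI v), v > 0. *)
Definition sech_freq (k : nat) : R := (2 * INR k + 1) * PI.

Lemma sech_freq_pos (k : nat) : 0 < sech_freq k.
Proof. unfold sech_freq; pose proof PI_RGT_0; pose proof (pos_INR k); nra. Qed.

Lemma pow_m1_sqr (n : nat) : (-1) ^ n * (-1) ^ n = 1.
Proof. rewrite <- Rpow_mult_distr; replace (-1 * -1) with 1 by ring; apply pow1. Qed.

Lemma Rabs_pow_m1 (n : nat) : Rabs ((-1) ^ n) = 1.
Proof. apply pow_1_abs. Qed.

(** Multiplied by cosh (PI v), each term becomes a sum of two neighbouring exponentials, so the
    alternating sum telescopes. The exact remainder is still valid at v = 0, where the infinite
    series diverges. *)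
Lemma sech_geometric (n : nat) (v : R) :
  / cosh (PI * v) - sum_f_R0 (fun k => 2 * (-1) ^ k * exp (- (sech_freq k * v))) n
  = (-1) ^ S n * exp (- (2 * INR (S n) * PI * v)) / cosh (PI * v).
Proof.
  assert (Hc := Rgt_not_eq _ _ (cosh_pos (PI * v))).
  assert (step : forall k : nat,
    2 * exp (- (sech_freq k * v)) * cosh (PI * v)
    = exp (- (2 * INR k * PI * v)) + exp (- (2 * INR (S k) * PI * v))).
  { intros k. unfold cosh, sech_freq. rewrite S_INR.
    replace (2 * exp (- ((2 * INR k + 1) * PI * v)) * ((exp (PI * v) + exp (- (PI * v))) / 2))
      with (exp (- ((2 * INR k + 1) * PI * v)) * exp (PI * v)
            + exp (- ((2 * INR k + 1) * PI * v)) * exp (- (PI * v))) by field.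
    rewrite <- !exp_plus. f_equal; f_equal; ring. }
  apply Rmult_eq_reg_r with (cosh (PI * v)); [|exact Hc].
  unfold Rdiv at 1. rewrite Rmult_assoc, Rinv_l, Rmult_1_r by exact Hc.
  rewrite Rmult_minus_distr_r, Rinv_l by exact Hc.
  induction n as [|n IH].
  - simpl sum_f_R0. rewrite Rmult_1_r, step.
    replace (- (2 * INR 0 * PI * v)) with 0 by (simpl; ring). rewrite exp_0. simpl pow. ring.
  - rewrite tech5, Rmult_plus_distr_r.
    replace (2 * (-1) ^ S n * exp (- (sech_freq (S n) * v)) * cosh (PI * v))
      with ((-1) ^ S n * (2 * exp (- (sech_freq (S n) * v)) * cosh (PI * v))) by ring.
    rewrite step. replace ((-1) ^ S (S n)) with (- (-1) ^ S n) by (simpl; ring). lra.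
Qed.

Definition sech_cos (t V : R) : R := RInt (fun v => cos (v * t) / cosh (PI * v)) 0 V.

Lemma continuous_sech_cos_integrand (t v : R) :
  continuous (fun v => cos (v * t) / cosh (PI * v)) v.
Proof.
  apply (@ex_derive_continuous R_AbsRing R_NormedModule). auto_derive. apply Rgt_not_eq, cosh_pos.
Qed.

Lemma is_derive_sech_cos (t V : R) :
  is_derive (sech_cos t) V (cos (V * t) / cosh (PI * V)).
Proof.
  apply (is_derive_RInt_upper (fun v => cos (v * t) / cosh (PI * v))).
  intros; apply continuous_sech_cos_integrand.
Qed.

Lemma Rabs_cos_le (x : R) : Rabs (cos x) <= 1.
Proof. apply Rabs_le, COS_bound. Qed.

Lemma Rabs_sin_le (x : R) : Rabs (sin x) <= 1.
Proof. apply Rabs_le, SIN_bound. Qed.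

Lemma Rabs_div_cosh (a x : R) : Rabs (a / cosh x) = Rabs a / cosh x.
Proof.
  unfold Rdiv. rewrite Rabs_mult, (Rabs_pos_eq (/ _)); [easy|].
  left; apply Rinv_0_lt_compat, cosh_pos.
Qed.

Lemma sech_cos_cauchy (t V W : R) :
  0 <= V <= W -> Rabs (sech_cos t W - sech_cos t V) <= exp (- (PI * V)).
Proof.
  intros HV. pose proof PI2_3_2.
  eapply Rle_trans.
  - apply (increment_bound (sech_cos t) (fun v => cos (v * t) / cosh (PI * v))
      (fun v => - (2 / PI * exp (- (PI * v)))) (fun v => 2 * exp (- (PI * v)))).
    + lra.
    + intros; apply is_derive_sech_cos.
    + intros. auto_derive; [easy|]. field; lra.
    + intros v Hv. rewrite Rabs_div_cosh.
      eapply Rle_trans; [|apply inv_cosh_le]. unfold Rdiv.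
      rewrite <- (Rmult_1_l (/ cosh _)) at 2.
      apply Rmult_le_compat_r; [left; apply Rinv_0_lt_compat, cosh_pos|apply Rabs_cos_le].
  - cbv beta. pose proof (exp_pos (- (PI * W))). pose proof (exp_pos (- (PI * V))).
    assert (0 < 2 / PI) by (apply Rdiv_lt_0_compat; lra).
    assert (2 / PI <= 1) by (apply Rmult_le_reg_r with PI; [lra|]; unfold Rdiv; rewrite Rmult_assoc, Rinv_l; lra).
    nra.
Qed.

(** Partial sums of the partial fraction expansion of 1 / (2 cosh (t / 2)); a / (a^2 + t^2) is the
    integral of exp (- a v) cos (v t) over v > 0. *)
Definition sech_cos_series (t : R) (n : nat) : R :=
  sum_f_R0 (fun k => 2 * (-1) ^ k * (sech_freq k / (sech_freq k ^ 2 + t ^ 2))) n.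

(** The primitive in v of exp (- a v) cos (v t) that vanishes at v = 0. *)
Definition exp_cos_primitive (a t v : R) : R :=
  (a + exp (- (a * v)) * (t * sin (v * t) - a * cos (v * t))) / (a ^ 2 + t ^ 2).

Lemma is_derive_sum_f_R0 (f df : nat -> R -> R) (n : nat) (x : R) :
  (forall k, is_derive (f k) x (df k x)) ->
  is_derive (fun y => sum_f_R0 (fun k => f k y) n) x (sum_f_R0 (fun k => df k x) n).
Proof.
  intros H; induction n as [|n IH]; simpl; [apply H|].
  apply (is_derive_plus (fun y => sum_f_R0 (fun k => f k y) n)); auto.
Qed.

Lemma is_lim_sum_f_R0 (f : nat -> R -> R) (l : nat -> R) (x : Rbar) (n : nat) :
  (forall k, is_lim (f k) x (l k)) ->
  is_lim (fun y => sum_f_R0 (fun k => f k y) n) x (sum_f_R0 l n).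
Proof.
  intros H; induction n as [|n IH]; simpl; [apply H|].
  apply (is_lim_plus' (fun y => sum_f_R0 (fun k => f k y) n)); auto.
Qed.

Lemma is_lim_exp_neg_mult (a : R) : 0 < a -> is_lim (fun v => exp (- (a * v))) p_infty 0.
Proof.
  intros Ha.
  apply (is_lim_comp (fun y => exp y) (fun v => - (a * v)) p_infty 0 m_infty).
  - apply is_lim_exp_m.
  - replace m_infty with (Rbar_opp (Rbar_mult a p_infty)).
    + apply is_lim_opp. apply is_lim_scal_l. apply is_lim_id.
    + simpl. destruct (Rle_dec 0 a) as [H|H]; [|lra].
      destruct (Rle_lt_or_eq_dec 0 a H); [easy|lra].
  - exists 0; easy.
Qed.

Lemma is_lim_exp_cos_primitive (a t : R) :
  0 < a -> is_lim (exp_cos_primitive a t) p_infty (a / (a ^ 2 + t ^ 2)).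
Proof.
  intros Ha.
  assert (Hp : 0 < a ^ 2 + t ^ 2) by (simpl; nra).
  pose (B := (Rabs t + a) / (a ^ 2 + t ^ 2)).
  assert (HB : 0 <= B).
  { apply Rmult_le_pos; [pose proof (Rabs_pos t); lra|left; now apply Rinv_0_lt_compat]. }
  apply (is_lim_le_le_loc (fun v => a / (a ^ 2 + t ^ 2) - B * exp (- (a * v)))
                          (fun v => a / (a ^ 2 + t ^ 2) + B * exp (- (a * v)))).
  - exists 0. intros v _.
    assert (Rabs (exp (- (a * v)) * (t * sin (v * t) - a * cos (v * t)) / (a ^ 2 + t ^ 2))
            <= B * exp (- (a * v))).
    { unfold B, Rdiv. rewrite !Rabs_mult, (Rabs_pos_eq (/ _)), (Rabs_pos_eq (exp _));
        [|left; apply exp_pos|left; now apply Rinv_0_lt_compat].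
      rewrite (Rmult_comm (exp _)), !Rmult_assoc, (Rmult_comm (exp _)), <- !Rmult_assoc.
      apply Rmult_le_compat_r; [left; apply exp_pos|].
      apply Rmult_le_compat_r; [left; now apply Rinv_0_lt_compat|].
      eapply Rle_trans; [apply Rabs_triang|]. rewrite Rabs_Ropp, !Rabs_mult.
      rewrite (Rabs_pos_eq a) by lra.
      pose proof (Rabs_pos t). pose proof (Rabs_sin_le (v * t)). pose proof (Rabs_cos_le (v * t)).
      nra. }
    apply Rabs_le_between in H.
    replace (exp_cos_primitive a t v) with (a / (a ^ 2 + t ^ 2) +
      exp (- (a * v)) * (t * sin (v * t) - a * cos (v * t)) / (a ^ 2 + t ^ 2))
      by (unfold exp_cos_primitive; field; simpl in *; lra). lra.
  - replace (a / (a ^ 2 + t ^ 2)) with (a / (a ^ 2 + t ^ 2) - B * 0) at 1 by ring.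
    apply is_lim_minus'; [apply is_lim_const|].
    apply (is_lim_scal_l _ B p_infty 0). now apply is_lim_exp_neg_mult.
  - replace (a / (a ^ 2 + t ^ 2)) with (a / (a ^ 2 + t ^ 2) + B * 0) at 1 by ring.
    apply is_lim_plus'; [apply is_lim_const|].
    apply (is_lim_scal_l _ B p_infty 0). now apply is_lim_exp_neg_mult.
Qed.

(** The difference vanishes at V = 0 and its derivative is the remainder of [sech_geometric] times a
    cosine. The bound 1 / cosh <= 2 is enlarged to 2 PI so that the majorant integrates to at most 1
    / (n + 1), uniformly in V. *)
Lemma sech_cos_truncation (t : R) (n : nat) (V : R) : 0 <= V ->
  Rabs (sech_cos t V
        - sum_f_R0 (fun k => 2 * (-1) ^ k * exp_cos_primitive (sech_freq k) t V) n)
  <= / INR (S n).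
Proof.
  intros HV. pose proof PI2_3_2.
  assert (HN : 0 < INR (S n)) by (apply lt_0_INR; lia).
  assert (Hp : forall k, 0 < sech_freq k ^ 2 + t ^ 2)
    by (intros k; pose proof (sech_freq_pos k); simpl; nra).
  pose (F := fun V => sech_cos t V
     - sum_f_R0 (fun k => 2 * (-1) ^ k * exp_cos_primitive (sech_freq k) t V) n).
  assert (F0 : F 0 = 0).
  { unfold F, sech_cos. rewrite RInt_point. 
    rewrite (sum_eq _ (fun _ => 0)).
    - rewrite sum_eq_R0; [unfold zero; simpl; ring|easy].
    - intros k _. unfold exp_cos_primitive.
      rewrite Rmult_0_r, Ropp_0, exp_0, Rmult_0_l, sin_0, cos_0. field.
      specialize (Hp k); simpl in Hp; lra. }
  change (Rabs (F V) <= / INR (S n)). rewrite <- (Rminus_0_r (F V)), <- F0.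
  eapply Rle_trans.
  - apply (increment_bound F
      (fun v => (-1) ^ S n * exp (- (2 * INR (S n) * PI * v)) / cosh (PI * v) * cos (v * t))
      (fun v => - (/ (INR (S n)) * exp (- (2 * INR (S n) * PI * v))))
      (fun v => 2 * PI * exp (- (2 * INR (S n) * PI * v)))); [lra| | |].
    + intros x _. rewrite <- sech_geometric. unfold F.
      rewrite Rmult_minus_distr_r.
      replace (/ cosh (PI * x) * cos (x * t)) with (cos (x * t) / cosh (PI * x))
        by (unfold Rdiv; ring).
      apply (is_derive_minus (sech_cos t)); [apply is_derive_sech_cos|].
      rewrite (Rmult_comm (sum_f_R0 _ _)), scal_sum.
      apply (is_derive_sum_f_R0
        (fun k v => 2 * (-1) ^ k * exp_cos_primitive (sech_freq k) t v)
        (fun k x => 2 * (-1) ^ k * exp (- (sech_freq k * x)) * cos (x * t))).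
      intros k. unfold exp_cos_primitive. auto_derive; [easy|].
      field. specialize (Hp k); simpl in Hp; lra.
    + intros x _. set (N := INR (S n)) in *. auto_derive; [easy|]. field. lra.
    + intros x Hx. unfold Rdiv. rewrite !Rabs_mult, Rabs_pow_m1, Rmult_1_l.
      rewrite (Rabs_pos_eq (exp _)) by (left; apply exp_pos).
      rewrite (Rabs_pos_eq (/ _)) by (left; apply Rinv_0_lt_compat, cosh_pos).
      pose proof (exp_pos (- (2 * INR (S n) * PI * x))).
      pose proof (Rabs_cos_le (x * t)). pose proof (Rabs_pos (cos (x * t))).
      assert (H3 : / cosh (PI * x) <= 2).
      { eapply Rle_trans; [apply inv_cosh_le|].
        assert (exp (- (PI * x)) <= exp 0) by (apply exp_le; nra). rewrite exp_0 in *; lra. }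
      assert (0 < / cosh (PI * x)) by (apply Rinv_0_lt_compat, cosh_pos).
      assert (/ cosh (PI * x) * Rabs (cos (x * t)) <= 2 * PI) by nra.
      rewrite Rmult_assoc, Rmult_comm. apply Rmult_le_compat_r; lra.
  - cbv beta. rewrite !Rmult_0_r, Ropp_0, exp_0.
    pose proof (exp_pos (- (2 * INR (S n) * PI * V))).
    pose proof (Rinv_0_lt_compat _ HN). nra.
Qed.

(** Pass through a second endpoint W >= V and let W tend to infinity: the finite sum converges term
    by term, and the bound does not involve W. *)
Lemma sech_cos_near_series (t V : R) (n : nat) : 0 <= V ->
  Rabs (sech_cos t V - sech_cos_series t n) <= exp (- (PI * V)) + / INR (S n).
Proof.
  intros HV.
  pose (B := fun W => sum_f_R0 (fun k => 2 * (-1) ^ k * exp_cos_primitive (sech_freq k) t W) n).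
  assert (HB : is_lim (fun W => Rabs (sech_cos t V - B W)) p_infty
                 (Rbar_abs (Finite (sech_cos t V - sech_cos_series t n)))).
  { apply is_lim_Rabs. apply (is_lim_minus' _ _ p_infty (sech_cos t V)); [apply is_lim_const|].
    apply is_lim_sum_f_R0. intros k. 
    apply (is_lim_scal_l _ (2 * (-1) ^ k) p_infty (sech_freq k / (sech_freq k ^ 2 + t ^ 2))).
    apply is_lim_exp_cos_primitive, sech_freq_pos. }
  refine (is_lim_le_loc _ (fun _ => exp (- (PI * V)) + / INR (S n)) p_infty
    (Rabs (sech_cos t V - sech_cos_series t n)) (exp (- (PI * V)) + / INR (S n)) _ HB
    (is_lim_const _ _)).
  exists V. intros W HW.
  replace (sech_cos t V - B W) with (- (sech_cos t W - sech_cos t V) + (sech_cos t W - B W)) by ring.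
  eapply Rle_trans; [apply Rabs_triang|]. rewrite Rabs_Ropp.
  apply Rplus_le_compat; [apply sech_cos_cauchy; lra|apply sech_cos_truncation; lra].
Qed.

(** * Summation of the partial fraction series *)

(** Each product of sine and cosine is a difference of consecutive sines. The variable x ranges over
    [0, 1/2], where the terms of [sech_cos_series] arise as integrals of cosh (t x) against
    cosines. *)
Lemma dirichlet_kernel (n : nat) (x : R) :
  2 * sin (PI * x) * sum_f_R0 (fun k => cos (sech_freq k * x)) n
  = sin (2 * INR (S n) * PI * x).
Proof.
  assert (step : forall k, 2 * sin (PI * x) * cos (sech_freq k * x)
    = sin (2 * INR (S k) * PI * x) - sin (2 * INR k * PI * x)).
  { intros k. rewrite S_INR. unfold sech_freq.
    replace (2 * (INR k + 1) * PI * x) with ((2 * INR k + 1) * PI * x + PI * x) by ring.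
    replace (2 * INR k * PI * x) with ((2 * INR k + 1) * PI * x - PI * x) by ring.
    rewrite sin_plus, sin_minus. ring. }
  induction n as [|n IH].
  - simpl sum_f_R0. rewrite step. 
    replace (2 * INR 0 * PI * x) with 0 by (simpl; ring). rewrite sin_0. ring.
  - rewrite tech5, Rmult_plus_distr_l, IH, step. ring.
Qed.

(** With y = PI x <= 2, the bound sin y >= y - y^3 / 6 and y^2 <= 4 give sin y >= y / 3, which is at
    least x because PI > 3. *)
Lemma sin_PI_mult_ge (x : R) : 0 <= x <= / 2 -> x <= sin (PI * x).
Proof.
  intros Hx. pose proof PI2_3_2. pose proof PI_4.
  assert (Hy : 3 * x <= PI * x <= 2) by (split; nra).
  set (y := PI * x) in *.
  destruct (pre_sin_bound y 0) as [H1 _]; [lra|lra|].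
  assert (E : sin_approx y (2 * 0 + 1) = y - y ^ 3 / 6).
  { unfold sin_approx, sin_term; simpl. field. }
  rewrite E in H1.
  assert (y * (y * y) <= y * 4) by (apply Rmult_le_compat_l; nra).
  simpl in H1. lra.
Qed.

Lemma Rabs_sinh_le (t x : R) : 0 <= x <= 1 ->
  Rabs (sinh (t * x)) <= Rabs t * cosh t * x.
Proof.
  intros Hx.
  replace (sinh (t * x)) with (sinh (t * x) - sinh (t * 0))
    by (rewrite Rmult_0_r, sinh_0; ring).
  replace (Rabs t * cosh t * x) with (Rabs t * cosh t * x - Rabs t * cosh t * 0) by ring.
  apply (increment_bound (fun x => sinh (t * x)) (fun x => t * cosh (t * x))
    (fun x => Rabs t * cosh t * x) (fun _ => Rabs t * cosh t)); [lra| | |].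
  - intros y _. auto_derive; [easy|]. ring.
  - intros y _. auto_derive; [easy|]. ring.
  - intros y Hy. rewrite Rabs_mult, (Rabs_pos_eq (cosh _)) by (left; apply cosh_pos).
    apply Rmult_le_compat_l; [apply Rabs_pos|].
    assert (M : forall u v, Rabs u <= v -> cosh u <= cosh v).
    { intros u v Huv. assert (Hu : cosh u = cosh (Rabs u)).
      { unfold Rabs; destruct (Rcase_abs u); [|easy].
        unfold cosh; rewrite Ropp_involutive; field. }
      rewrite Hu. unfold cosh.
      pose proof (Rabs_pos u). set (w := Rabs u) in *.
      assert (exp w * exp (- w) = 1) by (rewrite <- exp_plus, Rplus_opp_r; apply exp_0).
      assert (exp v * exp (- v) = 1) by (rewrite <- exp_plus, Rplus_opp_r; apply exp_0).
      assert (exp w <= exp v) by now apply exp_le.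
      assert (1 <= exp w) by (rewrite <- exp_0; now apply exp_le).
      pose proof (exp_pos (- w)). pose proof (exp_pos (- v)).
      (* Twice the difference of the two values of cosh, factored so that both factors are
         nonnegative for 0 <= w <= v. *)
      assert (E : exp v + exp (- v) - exp w - exp (- w)
        = (exp v - exp w) * (1 - exp (- w) * exp (- v))).
      { replace ((exp v - exp w) * (1 - exp (- w) * exp (- v)))
          with (exp v - exp w - (exp v * exp (- v)) * exp (- w) + (exp w * exp (- w)) * exp (- v)) by ring.
        rewrite H0, H1. ring. }
      assert (exp (- w) <= 1) by (rewrite <- exp_0; apply exp_le; lra).
      assert (exp (- v) <= 1) by (rewrite <- exp_0; apply exp_le; lra).
      assert (0 <= 1 - exp (- w) * exp (- v)) by nra.
      nra. }
    assert (Ht : cosh t = cosh (Rabs t)).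
    { unfold Rabs; destruct (Rcase_abs t); [|easy].
      unfold cosh; rewrite Ropp_involutive; field. }
    rewrite Ht. apply M. rewrite Rabs_mult, (Rabs_pos_eq y) by lra.
    pose proof (Rabs_pos t). nra.
Qed.

Lemma Rabs_cosh_minus_1_le (t x : R) : 0 <= x <= 1 ->
  Rabs (cosh (t * x) - 1) <= t ^ 2 * cosh t * x ^ 2.
Proof.
  intros Hx.
  replace (cosh (t * x) - 1) with (cosh (t * x) - cosh (t * 0))
    by (rewrite Rmult_0_r, cosh_0; ring).
  replace (t ^ 2 * cosh t * x ^ 2) with (t ^ 2 * cosh t * x ^ 2 - t ^ 2 * cosh t * 0 ^ 2) by ring.
  apply (increment_bound (fun x => cosh (t * x)) (fun x => t * sinh (t * x))
    (fun x => t ^ 2 * cosh t * x ^ 2) (fun x => 2 * t ^ 2 * cosh t * x)); [lra| | |].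
  - intros y _. auto_derive; [easy|]. ring.
  - intros y _. auto_derive; [easy|]. ring.
  - intros y Hy. rewrite Rabs_mult.
    pose proof (Rabs_sinh_le t y ltac:(lra)).
    eapply Rle_trans; [apply Rmult_le_compat_l; [apply Rabs_pos|exact H]|].
    replace (Rabs t * (Rabs t * cosh t * y)) with (Rabs t ^ 2 * cosh t * y) by ring.
    rewrite pow2_abs. pose proof (cosh_pos t). assert (0 <= t ^ 2) by apply pow2_ge_0.
    assert (0 <= t ^ 2 * cosh t * y) by (apply Rmult_le_pos; [apply Rmult_le_pos|]; lra).
    lra.
Qed.

(** The primitive of (cosh (t x) - 1) cos (a x) that vanishes at 0; the -1 provides the zero that
    cancels the one of sin (PI x). At x = 1/2 and a = [sech_freq k] the cosine drops out, leaving a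
    term of [sech_cos_series], times cosh (t / 2) / 2, minus a Leibniz term. *)
Definition cosh_cos_primitive (t a x : R) : R :=
  (a * cosh (t * x) * sin (a * x) + t * sinh (t * x) * cos (a * x)) / (a ^ 2 + t ^ 2)
  - sin (a * x) / a.

Lemma is_derive_cosh_cos_primitive (t a x : R) : 0 < a ->
  is_derive (cosh_cos_primitive t a) x ((cosh (t * x) - 1) * cos (a * x)).
Proof.
  intros Ha. assert (0 < a ^ 2 + t ^ 2) by (simpl; nra).
  unfold cosh_cos_primitive. auto_derive; [easy|]. field. simpl in *; split; lra.
Qed.

Lemma sin_sech_freq (k : nat) : sin (sech_freq k * / 2) = (-1) ^ k.
Proof.
  unfold sech_freq. replace ((2 * INR k + 1) * PI * / 2) with (PI / 2 + INR k * PI) by field.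
  induction k as [|k IH].
  - simpl. rewrite Rmult_0_l, Rplus_0_r. apply sin_PI2.
  - rewrite S_INR. replace (PI / 2 + (INR k + 1) * PI) with (PI / 2 + INR k * PI + PI) by ring.
    rewrite neg_sin, IH. simpl. ring.
Qed.

Lemma cos_sech_freq (k : nat) : cos (sech_freq k * / 2) = 0.
Proof.
  pose proof (sin2_cos2 (sech_freq k * / 2)) as H. rewrite sin_sech_freq in H.
  unfold Rsqr in H. rewrite pow_m1_sqr in H. nra.
Qed.

Definition leibniz_sum (n : nat) : R := sum_f_R0 (fun k => (-1) ^ k / sech_freq k) n.

Lemma is_lim_leibniz_sum : is_lim_seq leibniz_sum (/ 4).
Proof.
  pose proof Alt_PI_eq as HPI. unfold Alt_PI in HPI.
  destruct exist_PI as [l Hl]. pose proof PI_RGT_0.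
  apply is_lim_seq_Reals in Hl.
  replace (/ 4) with (/ PI * l) by (rewrite <- HPI; field; lra).
  eapply is_lim_seq_ext; [|apply (is_lim_seq_scal_l _ (/ PI) l Hl)].
  intros n. cbv beta. rewrite scal_sum. apply sum_eq. intros k _.
  unfold tg_alt, PI_tg, sech_freq. rewrite plus_INR, mult_INR. simpl INR.
  pose proof (pos_INR k). field. split; lra.
Qed.

(* Riemann-Lebesgue for q x = (cosh (t x) - 1) / sin (PI x), whose derivative is bounded near the
   removable singularity 0: Phi adds to the primitive of (cosh (t x) - 1) * (Dirichlet kernel) the
   boundary term of the integration by parts, so that Phi' = q' cos / (2 N PI) is O(1/N). *)
Lemma sech_cos_series_bound (t : R) : exists C : R, forall n : nat,
  Rabs (cosh (t / 2) * sech_cos_series t n / 2 - leibniz_sum n) <= C / INR (S n).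
Proof.
  pose proof PI2_3_2 as HPI. pose proof PI_4 as HPI4.
  pose (q := fun x => (cosh (t * x) - 1) / sin (PI * x)).
  pose (q' := fun x => (t * sinh (t * x) * sin (PI * x)
                        - (cosh (t * x) - 1) * (PI * cos (PI * x))) / (sin (PI * x)) ^ 2).
  pose (B := t ^ 2 * cosh t).
  assert (HB : 0 <= B) by (apply Rmult_le_pos; [apply pow2_ge_0|left; apply cosh_pos]).
  assert (Hsin : forall x, 0 < x <= / 2 -> x <= sin (PI * x))
    by (intros; apply sin_PI_mult_ge; lra).
  assert (Hq : forall x, 0 < x <= / 2 -> Rabs (q x) <= B * x).
  { intros x Hx. specialize (Hsin x Hx). unfold q, Rdiv.
    rewrite Rabs_mult, Rabs_inv, (Rabs_pos_eq (sin _)) by lra.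
    apply Rmult_le_reg_r with (sin (PI * x)); [lra|].
    rewrite Rmult_assoc, Rinv_l, Rmult_1_r by lra.
    eapply Rle_trans; [apply Rabs_cosh_minus_1_le; lra|]. fold B.
    assert (0 <= B * x) by (apply Rmult_le_pos; lra). simpl. nra. }
  (* The numerator is at most (1 + 4) B sin^2 (PI x), by PI <= 4 and x <= sin (PI x). Rounding 5 up
     to 8 turns 8 B / (4 N PI) * (1/2) into B / (N PI). *)
  assert (Hq' : forall x, 0 < x <= / 2 -> Rabs (q' x) <= 8 * B).
  { intros x Hx. specialize (Hsin x Hx). unfold q', Rdiv.
    assert (0 < sin (PI * x) ^ 2) by (apply pow_lt; lra).
    rewrite Rabs_mult, Rabs_inv, (Rabs_pos_eq (sin (PI * x) ^ 2)) by lra.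
    apply Rmult_le_reg_r with (sin (PI * x) ^ 2); [lra|].
    rewrite Rmult_assoc, Rinv_l, Rmult_1_r by lra.
    eapply Rle_trans; [apply Rabs_triang|]. rewrite Rabs_Ropp, !Rabs_mult.
    assert (H1 := Rabs_cosh_minus_1_le t x ltac:(lra)). fold B in H1.
    assert (H2 := Rabs_sinh_le t x ltac:(lra)).
    rewrite (Rabs_pos_eq (sin _)), (Rabs_pos_eq PI) by lra.
    assert (H3 : Rabs t * Rabs (sinh (t * x)) <= B * x).
    { unfold B. rewrite <- (pow2_abs t).
      replace (Rabs t ^ 2 * cosh t * x) with (Rabs t * (Rabs t * cosh t * x)) by ring.
      apply Rmult_le_compat_l; [apply Rabs_pos|exact H2]. }
    assert (H4 := Rabs_cos_le (PI * x)). assert (H5 := Rabs_pos (cos (PI * x))).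
    assert (H6 := Rabs_pos (cosh (t * x) - 1)).
    set (s := sin (PI * x)) in *.
    assert (H7 : x ^ 2 <= s ^ 2) by (apply pow_incr; lra).
    assert (H8 : B * x * s <= B * s ^ 2)
      by (replace (B * s ^ 2) with (B * s * s) by ring; apply Rmult_le_compat_r; [lra|]; apply Rmult_le_compat_l; lra).
    assert (H9 : B * x ^ 2 <= B * s ^ 2) by (apply Rmult_le_compat_l; lra).
    assert (H10 : Rabs t * Rabs (sinh (t * x)) * s <= B * x * s) by (apply Rmult_le_compat_r; lra).
    assert (H11 : Rabs (cosh (t * x) - 1) * (PI * Rabs (cos (PI * x))) <= B * x ^ 2 * 4).
    { apply Rmult_le_compat; nra. }
    assert (0 <= B * s ^ 2) by (apply Rmult_le_pos; lra). lra. }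
  exists (3 * B). intros n.
  assert (HN : 0 < INR (S n)) by (apply lt_0_INR; lia).
  set (N := INR (S n)) in *.
  pose (A := fun x => sum_f_R0 (fun k => cosh_cos_primitive t (sech_freq k) x) n).
  pose (Phi := fun x => A x + q x * cos (2 * N * PI * x) / (4 * N * PI)).
  assert (HA : forall x, is_derive A x
      ((cosh (t * x) - 1) * sum_f_R0 (fun k => cos (sech_freq k * x)) n)).
  { intros x. rewrite scal_sum.
    apply (is_derive_sum_f_R0 (fun k x => cosh_cos_primitive t (sech_freq k) x)
      (fun k x => cos (sech_freq k * x) * (cosh (t * x) - 1))).
    intros k. rewrite Rmult_comm. apply is_derive_cosh_cos_primitive, sech_freq_pos. }
  assert (HPhi : forall x, 0 < x <= / 2 ->
      is_derive Phi x (q' x * cos (2 * N * PI * x) / (4 * N * PI))).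
  { intros x Hx. specialize (Hsin x Hx).
    assert (Hk := dirichlet_kernel n x). fold N in Hk.
    set (K := sum_f_R0 (fun k => cos (sech_freq k * x)) n) in *.
    (* By the Dirichlet kernel (cosh (t x) - 1) K = q x sin (2 N PI x) / 2, which cancels the term
       from differentiating the cosine. *)
    replace (q' x * cos (2 * N * PI * x) / (4 * N * PI)) with
      ((cosh (t * x) - 1) * K + (q' x * cos (2 * N * PI * x) / (4 * N * PI)
        - q x * sin (2 * N * PI * x) / 2)).
    - apply (is_derive_plus A); [apply HA|]. unfold q, q'.
      auto_derive; [lra|]. field. repeat split; lra.
    - rewrite <- Hk. unfold q. field. split; lra. }
  assert (Hbound : forall e, 0 < e <= / 2 ->
     Rabs (Phi (/ 2) - Phi e) <= 8 * B / (4 * N * PI) * / 2).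
  { intros e He. eapply Rle_trans.
    - apply (increment_bound Phi (fun x => q' x * cos (2 * N * PI * x) / (4 * N * PI))
        (fun x => 8 * B / (4 * N * PI) * x) (fun _ => 8 * B / (4 * N * PI))); [lra| | |].
      + intros x Hx. apply HPhi; lra.
      + intros x _. auto_derive; [easy|]. ring.
      + intros x Hx. unfold Rdiv.
        assert (0 < 4 * N * PI) by nra.
        assert (0 < / (4 * N * PI)) by now apply Rinv_0_lt_compat.
        rewrite !Rabs_mult, (Rabs_pos_eq (/ _)) by lra.
        apply Rmult_le_compat_r; [lra|].
        specialize (Hq' x ltac:(lra)).
        pose proof (Rabs_cos_le (2 * N * PI * x)). pose proof (Rabs_pos (cos (2 * N * PI * x))).
        pose proof (Rabs_pos (q' x)). nra.
    - cbv beta. assert (0 <= 8 * B / (4 * N * PI)).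
      { apply Rmult_le_pos; [lra|left; apply Rinv_0_lt_compat; nra]. }
      nra. }
  (* At 0 the quotient [q] has the form 0 / 0, so the derivative formula holds only for x > 0; the
     left endpoint / e is sent to 0 through e -> +infinity. *)
  assert (HPhi0 : is_lim (fun e => Rabs (Phi (/ 2) - Phi (/ e))) p_infty (Rabs (Phi (/ 2)))).
  { assert (Hinv : is_lim (fun e => / e) p_infty 0).
    { apply (is_lim_inv (fun e => e) p_infty p_infty); [apply is_lim_id|easy]. }
    replace (Finite (Rabs (Phi (/ 2)))) with (Rbar_abs (Finite (Phi (/ 2) - 0)))
      by (rewrite Rminus_0_r; easy).
    apply is_lim_Rabs. apply (is_lim_minus' _ _ p_infty (Phi (/ 2)) 0); [apply is_lim_const|].
    unfold Phi. replace 0 with (0 + 0) by ring.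
    apply is_lim_plus'.
    - assert (A0 : A 0 = 0).
      { unfold A. apply sum_eq_R0. intros k _. unfold cosh_cos_primitive.
        rewrite !Rmult_0_r, sin_0, sinh_0. unfold Rdiv. ring. }
      replace (Finite 0) with (Finite (A 0)) by (now rewrite A0).
      refine (filterlim_comp _ _ _ (fun e => / e) A _ _ _ Hinv _).
      apply (@ex_derive_continuous R_AbsRing R_NormedModule). eexists; apply HA.
    - apply (is_lim_le_le_loc (fun e => - (B / (4 * N * PI) * / e)) (fun e => B / (4 * N * PI) * / e)).
      + exists 2. intros e He.
        assert (0 < / e <= / 2).
        { split; [apply Rinv_0_lt_compat; lra|apply Rinv_le_contravar; lra]. }
        apply Rabs_le_between.
        assert (0 < 4 * N * PI) by nra.
        assert (0 < / (4 * N * PI)) by now apply Rinv_0_lt_compat.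
        unfold Rdiv. rewrite !Rabs_mult, (Rabs_pos_eq (/ (4 * N * PI))) by lra.
        replace (B * / (4 * N * PI) * / e) with (B * / e * / (4 * N * PI)) by ring.
        apply Rmult_le_compat_r; [lra|].
        specialize (Hq _ H).
        pose proof (Rabs_cos_le (2 * N * PI * / e)). pose proof (Rabs_pos (cos (2 * N * PI * / e))).
        pose proof (Rabs_pos (q (/ e))). nra.
      + replace (Finite 0) with (Rbar_opp (Rbar_mult (B / (4 * N * PI)) 0))
          by (simpl; rewrite Rmult_0_r, Ropp_0; easy).
        apply is_lim_opp, is_lim_scal_l, Hinv.
      + replace (Finite 0) with (Rbar_mult (B / (4 * N * PI)) 0)
          by (simpl; rewrite Rmult_0_r; easy).
        apply is_lim_scal_l, Hinv. }
  assert (Hfin : Rabs (Phi (/ 2)) <= 8 * B / (4 * N * PI) * / 2).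
  { refine (is_lim_le_loc _ _ p_infty (Rabs (Phi (/ 2))) (8 * B / (4 * N * PI) * / 2) _ HPhi0
      (is_lim_const _ _)).
    exists 2. intros e He. apply Hbound.
    split; [apply Rinv_0_lt_compat; lra|apply Rinv_le_contravar; lra]. }
  assert (HA2 : A (/ 2) = cosh (t / 2) * sech_cos_series t n / 2 - leibniz_sum n).
  { unfold A, sech_cos_series, leibniz_sum.
    replace (cosh (t / 2) * sum_f_R0 (fun k => 2 * (-1) ^ k * (sech_freq k / (sech_freq k ^ 2 + t ^ 2))) n / 2)
      with (cosh (t / 2) / 2 * sum_f_R0 (fun k => 2 * (-1) ^ k * (sech_freq k / (sech_freq k ^ 2 + t ^ 2))) n)
      by field.
    rewrite scal_sum, <- minus_sum. apply sum_eq. intros k _.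
    unfold cosh_cos_primitive. rewrite sin_sech_freq, cos_sech_freq.
    pose proof (sech_freq_pos k). fold (t / 2). field. split; simpl; nra. }
  replace (cosh (t / 2) * sech_cos_series t n / 2 - leibniz_sum n)
    with (Phi (/ 2) - q (/ 2) * cos (2 * N * PI * / 2) / (4 * N * PI))
    by (rewrite <- HA2; unfold Phi; ring).
  eapply Rle_trans; [apply Rabs_triang|]. rewrite Rabs_Ropp.
  assert (H0 : 0 < / (N * PI)) by (apply Rinv_0_lt_compat; nra).
  assert (H1 : Rabs (q (/ 2) * cos (2 * N * PI * / 2) / (4 * N * PI)) <= B * / (N * PI)).
  { replace (q (/ 2) * cos (2 * N * PI * / 2) / (4 * N * PI))
      with (q (/ 2) * cos (2 * N * PI * / 2) / 4 * / (N * PI)) by (field; split; lra).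
    rewrite Rabs_mult, (Rabs_pos_eq (/ (N * PI))) by lra.
    apply Rmult_le_compat_r; [lra|]. unfold Rdiv. rewrite !Rabs_mult, (Rabs_pos_eq (/ 4)) by lra.
    specialize (Hq (/ 2) ltac:(lra)).
    pose proof (Rabs_cos_le (2 * N * PI * / 2)). pose proof (Rabs_pos (cos (2 * N * PI * / 2))).
    pose proof (Rabs_pos (q (/ 2))). nra. }
  assert (H2 : 8 * B / (4 * N * PI) * / 2 = B * / (N * PI)) by (field; split; lra).
  assert (H3 : / (N * PI) <= / N).
  { apply Rinv_le_contravar; nra. }
  assert (B * / (N * PI) <= B * / N) by (apply Rmult_le_compat_l; lra).
  assert (0 <= B * / N) by (apply Rmult_le_pos; [lra|left; now apply Rinv_0_lt_compat]).
  unfold Rdiv. lra.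
Qed.

Lemma is_lim_seq_inv_S : is_lim_seq (fun n => / INR (S n)) 0.
Proof.
  apply (is_lim_seq_incr_1 (fun n => / INR n)).
  apply (is_lim_seq_inv INR p_infty); [apply is_lim_seq_INR|easy].
Qed.

Lemma is_lim_sech_cos_series (t : R) : is_lim_seq (sech_cos_series t) (/ (2 * cosh (t / 2))).
Proof.
  destruct (sech_cos_series_bound t) as [C HC].
  pose proof (cosh_pos (t / 2)).
  assert (L : is_lim_seq (fun n => cosh (t / 2) * sech_cos_series t n / 2 - leibniz_sum n) 0).
  { apply is_lim_seq_abs_0. apply (is_lim_seq_le_le (fun _ => 0) _ (fun n => C * / INR (S n))).
    - intros n; split; [apply Rabs_pos|apply HC].
    - apply is_lim_seq_const.
    - replace (Finite 0) with (Rbar_mult C 0) by (simpl; rewrite Rmult_0_r; easy).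
      apply is_lim_seq_scal_l, is_lim_seq_inv_S. }
  assert (L2 := is_lim_seq_plus' _ _ _ _ L is_lim_leibniz_sum).
  assert (L3 := is_lim_seq_scal_l _ (2 / cosh (t / 2)) _ L2).
  replace (Finite (/ (2 * cosh (t / 2)))) with (Rbar_mult (2 / cosh (t / 2)) (0 + / 4))
    by (simpl; f_equal; field; lra).
  eapply is_lim_seq_ext; [|exact L3]. intros n; cbv beta. field; lra.
Qed.

Lemma sech_cos_near_sech (t V : R) : 0 <= V ->
  Rabs (sech_cos t V - / (2 * cosh (t / 2))) <= exp (- (PI * V)).
Proof.
  intros HV.
  assert (L1 : is_lim_seq (fun n => Rabs (sech_cos t V - sech_cos_series t n))
    (Rabs (sech_cos t V - / (2 * cosh (t / 2))))).
  { apply (is_lim_seq_abs _ (sech_cos t V - / (2 * cosh (t / 2)))).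
    apply is_lim_seq_minus'; [apply is_lim_seq_const|apply is_lim_sech_cos_series]. }
  assert (L2 : is_lim_seq (fun n => exp (- (PI * V)) + / INR (S n)) (exp (- (PI * V)))).
  { replace (Finite (exp (- (PI * V)))) with (Finite (exp (- (PI * V)) + 0)) by (f_equal; ring).
    apply is_lim_seq_plus'; [apply is_lim_seq_const|apply is_lim_seq_inv_S]. }
  apply (is_lim_seq_le _ _ (Rabs (sech_cos t V - / (2 * cosh (t / 2)))) (exp (- (PI * V)))
    (fun n => sech_cos_near_series t V n HV) L1 L2).
Qed.

(** * The transform of the main term *)

(* The real part of exp (t (1 - s)) / (1 - s) at s = 1/2 + iv. *)
Definition re_power_primitive (t v : R) : R :=
  exp (t / 2) * ((cos (v * t) / 2 + v * sin (v * t)) / (/ 4 + v ^ 2)).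

(** The truncated pairing of Re (x^(1-s) / (1-s)) at x = exp t. The word primitive refers to t: the
    t-derivative is exp (t / 2) * [sech_cos t V]. *)
Definition sech_power_primitive (t V : R) : R :=
  RInt (fun v => re_power_primitive t v / cosh (PI * v)) 0 V.

Lemma quarter_plus_sqr_pos (v : R) : 0 < / 4 + v ^ 2.
Proof. pose proof (pow2_ge_0 v); lra. Qed.

Lemma is_derive_re_power_primitive (t v : R) :
  is_derive (fun t => re_power_primitive t v / cosh (PI * v)) t
    (exp (t / 2) * (cos (v * t) / cosh (PI * v))).
Proof.
  pose proof (quarter_plus_sqr_pos v). pose proof (cosh_pos (PI * v)).
  unfold re_power_primitive. auto_derive; [easy|].
  change (t / 2) with (t * / 2). field. simpl in *; split; lra.
Qed.

Lemma continuous_re_power_primitive (t v : R) :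
  continuous (fun v => re_power_primitive t v / cosh (PI * v)) v.
Proof.
  pose proof (quarter_plus_sqr_pos v). pose proof (cosh_pos (PI * v)).
  apply (@ex_derive_continuous R_AbsRing R_NormedModule).
  unfold re_power_primitive. auto_derive. simpl in *; repeat split; lra.
Qed.

Lemma continuity_2d_sech_power (t v : R) :
  continuity_2d_pt (fun t v => exp (t / 2) * (cos (v * t) / cosh (PI * v))) t v.
Proof.
  assert (H1 : forall f : R -> R, (forall x, ex_derive f x) -> forall x, continuity_pt f x).
  { intros f Hf x. apply continuity_pt_filterlim, (@ex_derive_continuous R_AbsRing R_NormedModule), Hf. }
  apply continuity_2d_pt_mult.
  - apply (continuity_1d_2d_pt_comp (fun y => exp (y / 2)) (fun t _ => t)); [|apply continuity_2d_pt_id1].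
    apply H1. intros; auto_derive; easy.
  - unfold Rdiv. apply continuity_2d_pt_mult.
    + apply (continuity_1d_2d_pt_comp cos (fun t v => v * t)).
      * apply continuity_cos.
      * apply continuity_2d_pt_mult; [apply continuity_2d_pt_id2|apply continuity_2d_pt_id1].
    + apply (continuity_1d_2d_pt_comp (fun y => / cosh (PI * y)) (fun _ v => v)); [|apply continuity_2d_pt_id2].
      apply H1. intros x; auto_derive. apply Rgt_not_eq, cosh_pos.
Qed.

Lemma is_derive_sech_power_primitive (t V : R) :
  is_derive (fun t => sech_power_primitive t V) t (exp (t / 2) * sech_cos t V).
Proof.
  assert (HD : forall t v, Derive (fun t => re_power_primitive t v / cosh (PI * v)) t
                = exp (t / 2) * (cos (v * t) / cosh (PI * v)))
    by (intros; apply is_derive_unique, is_derive_re_power_primitive).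
  assert (E : exp (t / 2) * sech_cos t V
    = RInt (fun v => Derive (fun t => re_power_primitive t v / cosh (PI * v)) t) 0 V).
  { unfold sech_cos.
    transitivity (RInt (fun v => scal (exp (t / 2)) (cos (v * t) / cosh (PI * v))) 0 V).
    - symmetry. apply (@RInt_scal R_CompleteNormedModule).
      apply ex_RInt_everywhere_continuous. intros; apply continuous_sech_cos_integrand.
    - apply RInt_ext. intros. symmetry. apply HD. }
  rewrite E. unfold sech_power_primitive.
  apply (is_derive_RInt_param (fun t v => re_power_primitive t v / cosh (PI * v))).
  - exists posreal_one. intros y _ v _. eexists. apply is_derive_re_power_primitive.
  - intros v _.
    apply (continuity_2d_pt_ext (fun t v => exp (t / 2) * (cos (v * t) / cosh (PI * v)))).
    + intros; symmetry; apply HD.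
    + apply continuity_2d_sech_power.
  - exists posreal_one. intros y _.
    apply ex_RInt_everywhere_continuous, continuous_re_power_primitive.
Qed.

(** Crude in V, but V is fixed when this is used: only the decay as t -> -infinity matters. The
    constant is 2 * 3, from 1 / cosh <= 2 and 1/2 + v <= 3 (1/4 + v^2). *)
Lemma Rabs_sech_power_primitive_le (t V : R) : 0 <= V ->
  Rabs (sech_power_primitive t V) <= 6 * V * exp (t / 2).
Proof.
  intros HV.
  replace (sech_power_primitive t V) with (sech_power_primitive t V - sech_power_primitive t 0).
  2:{ unfold sech_power_primitive at 2. rewrite RInt_point. unfold zero; simpl; ring. }
  replace (6 * V * exp (t / 2)) with (6 * exp (t / 2) * V - 6 * exp (t / 2) * 0) by ring.
  apply (increment_bound (sech_power_primitive t) (fun v => re_power_primitive t v / cosh (PI * v))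
    (fun v => 6 * exp (t / 2) * v) (fun _ => 6 * exp (t / 2))); [lra| | |].
  - intros x _. apply (is_derive_RInt_upper (fun v => re_power_primitive t v / cosh (PI * v))).
    intros; apply continuous_re_power_primitive.
  - intros x _. auto_derive; [easy|]. ring.
  - intros v Hv. rewrite Rabs_div_cosh. unfold re_power_primitive.
    pose proof (quarter_plus_sqr_pos v) as Hq. pose proof (exp_pos (t / 2)) as He.
    assert (Hc : 0 < / cosh (PI * v)) by apply Rinv_0_lt_compat, cosh_pos.
    assert (Hc2 : / cosh (PI * v) <= 2).
    { eapply Rle_trans; [apply inv_cosh_le|]. pose proof PI_RGT_0.
      assert (exp (- (PI * v)) <= exp 0) by (apply exp_le; nra). rewrite exp_0 in *; lra. }
    assert (Hb : Rabs ((cos (v * t) / 2 + v * sin (v * t)) / (/ 4 + v ^ 2)) <= 3).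
    { unfold Rdiv at 1. rewrite Rabs_mult, Rabs_inv, (Rabs_pos_eq (/ 4 + v ^ 2)) by lra.
      apply Rmult_le_reg_r with (/ 4 + v ^ 2); [lra|].
      rewrite Rmult_assoc, Rinv_l, Rmult_1_r by lra.
      eapply Rle_trans; [apply Rabs_triang|]. unfold Rdiv. rewrite !Rabs_mult.
      rewrite (Rabs_pos_eq v), (Rabs_pos_eq (/ 2)) by lra.
      pose proof (Rabs_cos_le (v * t)). pose proof (Rabs_sin_le (v * t)).
      assert (v * Rabs (sin (v * t)) <= v * 1) by (apply Rmult_le_compat_l; lra).
      pose proof (pow2_ge_0 (v - / 2)). simpl in *. nra. }
    rewrite Rabs_mult, (Rabs_pos_eq (exp _)) by lra.
    pose proof (Rabs_pos ((cos (v * t) / 2 + v * sin (v * t)) / (/ 4 + v ^ 2))).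
    set (z := Rabs _) in *.
    replace (exp (t / 2) * z / cosh (PI * v)) with (exp (t / 2) * (z * / cosh (PI * v)))
      by (unfold Rdiv; ring).
    rewrite (Rmult_comm 6).
    apply Rmult_le_compat_l; [lra|]. nra.
Qed.

(** Since exp (t / 2) / (2 cosh (t / 2)) = exp t / (1 + exp t) is the derivative of ln (1 + exp t),
    [sech_cos_near_sech] bounds the derivative of the difference. Both terms vanish as t ->
    -infinity, so no constant of integration is left. *)
Lemma sech_power_primitive_near_ln (t V : R) : 0 <= V ->
  Rabs (sech_power_primitive t V - ln (1 + exp t)) <= 2 * exp (- (PI * V)) * exp (t / 2).
Proof.
  intros HV.
  pose (D := fun t => sech_power_primitive t V - ln (1 + exp t)).
  pose (d := exp (- (PI * V))).
  assert (Hinc : forall t0, t0 <= t -> Rabs (D t - D t0) <= 2 * d * exp (t / 2) - 2 * d * exp (t0 / 2)).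
  { intros t0 Ht0.
    apply (increment_bound D (fun t => exp (t / 2) * (sech_cos t V - / (2 * cosh (t / 2))))
      (fun t => 2 * d * exp (t / 2)) (fun t => d * exp (t / 2))); [easy| | |].
    - intros x _. rewrite Rmult_minus_distr_l.
      apply (is_derive_minus (fun t => sech_power_primitive t V));
        [apply is_derive_sech_power_primitive|].
      pose proof (exp_pos x). pose proof (exp_pos (x / 2)).
      auto_derive; [lra|]. change (x * / 2) with (x / 2). unfold cosh. rewrite exp_Ropp.
      replace (exp x) with (exp (x / 2) * exp (x / 2)) by (rewrite <- exp_plus; f_equal; field).
      field. repeat split; nra.
    - intros x _. auto_derive; [easy|]. change (x * / 2) with (x / 2). field.
    - intros x _. rewrite Rabs_mult, (Rabs_pos_eq (exp _)) by (left; apply exp_pos).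
      rewrite Rmult_comm. apply Rmult_le_compat_r; [left; apply exp_pos|].
      now apply sech_cos_near_sech. }
  assert (Hd : 0 < d) by apply exp_pos.
  assert (Hb : forall u, - t <= u ->
    Rabs (D t) <= 2 * d * exp (t / 2) + (6 * V * exp (- (/ 2 * u)) + exp (- (1 * u)))).
  { intros u Hu. replace (D t) with ((D t - D (- u)) + D (- u)) by ring.
    eapply Rle_trans; [apply Rabs_triang|]. apply Rplus_le_compat.
    - eapply Rle_trans; [apply Hinc; lra|]. pose proof (exp_pos (- u / 2)). nra.
    - unfold D. eapply Rle_trans; [apply Rabs_triang|]. rewrite Rabs_Ropp.
      apply Rplus_le_compat.
      + replace (- (/ 2 * u)) with (- u / 2) by field. now apply Rabs_sech_power_primitive_le.
      + replace (1 * u) with u by ring.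
        pose proof (exp_pos (- u)). 
        rewrite Rabs_pos_eq by (rewrite <- ln_1; apply ln_le; lra).
        rewrite <- (ln_exp (exp (- u))) at 2. apply ln_le; [lra|].
        left. now apply exp_ineq1, Rgt_not_eq. }
  assert (L : is_lim (fun u => 2 * d * exp (t / 2) + (6 * V * exp (- (/ 2 * u)) + exp (- (1 * u))))
    p_infty (2 * d * exp (t / 2))).
  { replace (Finite (2 * d * exp (t / 2))) with (Finite (2 * d * exp (t / 2) + (6 * V * 0 + 0)))
      by (f_equal; ring).
    apply is_lim_plus'; [apply is_lim_const|]. apply is_lim_plus'.
    - apply (is_lim_scal_l _ (6 * V) p_infty 0). apply is_lim_exp_neg_mult; lra.
    - apply is_lim_exp_neg_mult; lra. }
  refine (is_lim_le_loc (fun _ => Rabs (D t)) _ p_infty (Rabs (D t)) (2 * d * exp (t / 2)) _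
    (is_lim_const _ _) L).
  exists (- t). intros u Hu. apply Hb. lra.
Qed.

(** * Real analyticity and the identity theorem *)

Definition poly_sum (a : nat -> R) (K : nat) (h : R) : R := sum_f_R0 (fun k => a k * h ^ k) K.

(* Real analyticity at [x], in the form of uniform remainder bounds: this is stable under the limits
   needed here without any interchange of infinite sums. *)
Definition jet (f : R -> R) (x : R) : Prop :=
  exists (a : nat -> R) (C rho : R), 0 < rho /\
    forall (K : nat) (h : R), Rabs h < rho ->
      Rabs (f (x + h) - poly_sum a K h) <= C * (Rabs h / rho) ^ S K.

Lemma ratio_bounds (h rho : R) : Rabs h < rho -> 0 <= Rabs h / rho < 1.
Proof.
  intros H. pose proof (Rabs_pos h). split.
  - apply Rmult_le_pos; [easy|left; apply Rinv_0_lt_compat; lra].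
  - apply Rmult_lt_reg_r with rho; [lra|]. unfold Rdiv. rewrite Rmult_assoc, Rinv_l; lra.
Qed.

Lemma jet_const_nonneg (f : R -> R) (x : R) (a : nat -> R) (C rho : R) : 0 < rho ->
  (forall (K : nat) (h : R), Rabs h < rho ->
    Rabs (f (x + h) - poly_sum a K h) <= C * (Rabs h / rho) ^ S K) -> 0 <= C.
Proof.
  intros Hr H. specialize (H O (rho / 2)).
  rewrite (Rabs_pos_eq (rho / 2)) in H by lra. specialize (H ltac:(lra)).
  replace (rho / 2 / rho) with (/ 2) in H by (field; lra).
  pose proof (Rabs_pos (f (x + rho / 2) - poly_sum a 0 (rho / 2))). simpl in H. lra.
Qed.

Lemma jet_ext (f g : R -> R) (x : R) : (forall y, f y = g y) -> jet f x -> jet g x.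
Proof.
  intros E [a [C [rho [Hr H]]]]. exists a, C, rho. split; [easy|]. intros; rewrite <- E; auto.
Qed.

Lemma jet_const (c x : R) : jet (fun _ => c) x.
Proof.
  exists (fun k => match k with O => c | _ => 0 end), 0, 1. split; [lra|]. intros K h _.
  assert (E : poly_sum (fun k => match k with O => c | _ => 0 end) K h = c).
  { unfold poly_sum. induction K as [|K IH]; simpl; [ring|]. simpl in IH. rewrite IH. ring. }
  rewrite E. unfold Rminus. rewrite Rplus_opp_r, Rabs_R0. lra.
Qed.

Lemma jet_scal (c : R) (f : R -> R) (x : R) : jet f x -> jet (fun y => c * f y) x.
Proof.
  intros [a [C [rho [Hr H]]]]. exists (fun k => c * a k), (Rabs c * C), rho. split; [easy|].
  intros K h Hh.
  replace (poly_sum (fun k => c * a k) K h) with (c * poly_sum a K h).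
  - rewrite <- Rmult_minus_distr_l, Rabs_mult, Rmult_assoc.
    apply Rmult_le_compat_l; [apply Rabs_pos|auto].
  - unfold poly_sum. rewrite scal_sum. apply sum_eq. intros; ring.
Qed.

Lemma jet_plus (f g : R -> R) (x : R) : jet f x -> jet g x -> jet (fun y => f y + g y) x.
Proof.
  intros [a [C [rho [Hr H]]]] [b [D [tau [Ht G]]]].
  assert (HC := jet_const_nonneg _ _ _ _ _ Hr H). assert (HD := jet_const_nonneg _ _ _ _ _ Ht G).
  exists (fun k => a k + b k), (C + D), (Rmin rho tau).
  split; [now apply Rmin_pos|]. intros K h Hh.
  pose proof (Rmin_l rho tau) as m1. pose proof (Rmin_r rho tau) as m2.
  assert (m0 : 0 < Rmin rho tau) by now apply Rmin_pos.
  set (m := Rmin rho tau) in *.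
  assert (mono : forall s, 0 < s -> m <= s -> (Rabs h / s) ^ S K <= (Rabs h / m) ^ S K).
  { intros s Hs Hms. apply pow_incr. split.
    - apply Rmult_le_pos; [apply Rabs_pos|left; now apply Rinv_0_lt_compat].
    - apply Rmult_le_compat_l; [apply Rabs_pos|]. now apply Rinv_le_contravar. }
  replace (poly_sum (fun k => a k + b k) K h) with (poly_sum a K h + poly_sum b K h).
  - replace (f (x + h) + g (x + h) - (poly_sum a K h + poly_sum b K h))
      with ((f (x + h) - poly_sum a K h) + (g (x + h) - poly_sum b K h)) by ring.
    eapply Rle_trans; [apply Rabs_triang|].
    specialize (H K h ltac:(lra)). specialize (G K h ltac:(lra)).
    pose proof (mono rho Hr m1). pose proof (mono tau Ht m2).
    assert (C * (Rabs h / rho) ^ S K <= C * (Rabs h / m) ^ S K) by (apply Rmult_le_compat_l; lra).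
    assert (D * (Rabs h / tau) ^ S K <= D * (Rabs h / m) ^ S K) by (apply Rmult_le_compat_l; lra).
    lra.
  - unfold poly_sum. rewrite <- sum_plus. apply sum_eq. intros; ring.
Qed.

Lemma jet_minus (f g : R -> R) (x : R) : jet f x -> jet g x -> jet (fun y => f y - g y) x.
Proof.
  intros Hf Hg. apply (jet_ext (fun y => f y + -1 * g y)); [intros; ring|].
  apply jet_plus; [easy|now apply jet_scal].
Qed.

(** From (x + h) f (x + h) = x f (x + h) + h f (x + h), where the second summand needs the remainder
    of order K - 1 only. For K = 0 there is none, hence [a O] in the constant. This yields all
    polynomial coefficients in sigma without general products of jets. *)
Lemma jet_mult_id (f : R -> R) (x : R) : jet f x -> jet (fun y => y * f y) x.
Proof.
  intros [a [C [rho [Hr H]]]]. assert (HC := jet_const_nonneg _ _ _ _ _ Hr H).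
  pose (b := fun k => x * a k + match k with O => 0 | S j => a j end).
  exists b, (Rabs x * C + rho * (C + Rabs (a O))), rho. split; [easy|]. intros K h Hh.
  pose proof (ratio_bounds h rho Hh) as Hrat.
  assert (Eh : Rabs h = rho * (Rabs h / rho)) by (field; lra).
  set (r := Rabs h / rho) in *.
  destruct K as [|K].
  - replace ((x + h) * f (x + h) - poly_sum b 0 h)
      with (x * (f (x + h) - poly_sum a 0 h) + h * ((f (x + h) - poly_sum a 0 h) + a O))
      by (unfold b, poly_sum; simpl; ring).
    specialize (H O h Hh). fold r in H. simpl in H. simpl pow.
    eapply Rle_trans; [apply Rabs_triang|]. rewrite !Rabs_mult, Eh.
    pose proof (Rabs_triang (f (x + h) - poly_sum a 0 h) (a O)) as Ht.
    pose proof (Rabs_pos x). pose proof (Rabs_pos (a O)).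
    set (z := Rabs (f (x + h) - poly_sum a 0 h)) in *.
    assert (Rabs x * z <= Rabs x * (C * (r * 1))) by (apply Rmult_le_compat_l; lra).
    assert (C * (r * 1) <= C) by nra.
    assert (rho * r * Rabs (f (x + h) - poly_sum a 0 h + a O) <= rho * r * (C + Rabs (a O))).
    { apply Rmult_le_compat_l; [apply Rmult_le_pos; lra|lra]. }
    lra.
  - assert (E : poly_sum b (S K) h = x * poly_sum a (S K) h + h * poly_sum a K h).
    { clear. unfold poly_sum. induction K as [|K IH]; [unfold b; simpl; ring|].
      rewrite tech5, IH, (tech5 (fun k => a k * h ^ k) (S K)), (tech5 (fun k => a k * h ^ k) K).
      unfold b. simpl pow. ring. }
    replace ((x + h) * f (x + h) - poly_sum b (S K) h)
      with (x * (f (x + h) - poly_sum a (S K) h) + h * (f (x + h) - poly_sum a K h))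
      by (rewrite E; ring).
    eapply Rle_trans; [apply Rabs_triang|]. rewrite !Rabs_mult, Eh.
    pose proof (H (S K) h Hh) as H1. pose proof (H K h Hh) as H2. fold r in H1, H2.
    pose proof (Rabs_pos x). pose proof (Rabs_pos (a O)).
    assert (0 <= r ^ S (S K)) by (apply pow_le; lra).
    assert (E1 := Rmult_le_compat_l _ _ _ H0 H1).
    assert (E2 := Rmult_le_compat_l (rho * r) _ _ ltac:(apply Rmult_le_pos; lra) H2).
    replace (rho * r * (C * r ^ S K)) with (rho * C * r ^ S (S K)) in E2 by (simpl; ring).
    assert (0 <= rho * Rabs (a O) * r ^ S (S K)) by (apply Rmult_le_pos; [apply Rmult_le_pos|]; lra).
    lra.
Qed.

Lemma small_multiple_zero (c M d : R) : 0 < d -> (forall h, 0 < h < d -> Rabs c <= M * h) -> c = 0.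
Proof.
  intros Hd H. apply Rabs_eq_0. apply Rle_antisym; [|apply Rabs_pos].
  apply Rnot_lt_le. intros Hc.
  pose proof (Rabs_pos M). pose proof (Rle_abs M).
  pose (h := Rmin (d / 2) (Rabs c / (2 * (Rabs M + 1)))).
  assert (0 < Rabs c / (2 * (Rabs M + 1))) by (apply Rdiv_lt_0_compat; lra).
  assert (Hh : 0 < h < d).
  { unfold h. pose proof (Rmin_l (d / 2) (Rabs c / (2 * (Rabs M + 1)))).
    split; [apply Rmin_pos; lra|lra]. }
  specialize (H h Hh).
  assert (h <= Rabs c / (2 * (Rabs M + 1))) by apply Rmin_r.
  assert (E : Rabs c / (2 * (Rabs M + 1)) * (Rabs M + 1) = Rabs c / 2) by (field; lra).
  nra.
Qed.

(** If the coefficients below j vanish, the remainder bound to the right of x reads |a_j| h^j <= C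
    (h / rho)^(j+1), so a_j = 0 as h -> 0. With all coefficients zero, K -> infinity gives f = 0 on
    both sides of x. *)
Lemma jet_vanishing (f : R -> R) (x : R) : jet f x ->
  (forall y, x < y -> f y = 0) -> exists d, 0 < d /\ forall y, Rabs (y - x) < d -> f y = 0.
Proof.
  intros [a [C [rho [Hr H]]]] Hf. assert (HC := jet_const_nonneg _ _ _ _ _ Hr H).
  assert (Hz : forall j k, (k <= j)%nat -> a k = 0).
  { assert (step : forall j, (forall k, (k < j)%nat -> a k = 0) -> a j = 0).
    { intros j Hj. apply (small_multiple_zero _ (C / rho ^ S j) rho Hr). intros h Hh.
      specialize (H j h). rewrite (Rabs_pos_eq h) in H by lra. specialize (H ltac:(lra)).
      rewrite Hf in H by lra.
      assert (E : poly_sum a j h = a j * h ^ j).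
      { unfold poly_sum. destruct j as [|j]; [easy|].
        rewrite tech5, sum_eq_R0; [ring|]. intros k Hk. rewrite Hj by lia. ring. }
      rewrite E in H. unfold Rminus in H. rewrite Rplus_0_l, Rabs_Ropp, Rabs_mult in H.
      assert (Hp : 0 < h ^ j) by (apply pow_lt; lra).
      rewrite (Rabs_pos_eq (h ^ j)) in H by lra.
      apply Rmult_le_reg_r with (h ^ j); [easy|].
      eapply Rle_trans; [exact H|]. right. unfold Rdiv. rewrite Rpow_mult_distr, pow_inv.
      simpl. ring. }
    induction j as [|j IH]; intros k Hk.
    - replace k with O by lia. apply step. intros; lia.
    - destruct (Nat.eq_dec k (S j)) as [->|]; [|apply IH; lia].
      apply step. intros; apply IH; lia. }
  exists rho. split; [easy|]. intros y Hy.
  replace y with (x + (y - x)) by ring. set (h := y - x) in *.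
  pose proof (ratio_bounds h rho Hy) as Hrat.
  assert (Hb : forall K, Rabs (f (x + h)) <= C * (Rabs h / rho) ^ S K).
  { intros K. specialize (H K h Hy).
    assert (E : poly_sum a K h = 0).
    { apply sum_eq_R0. intros k Hk. rewrite (Hz K k Hk). ring. }
    rewrite E, Rminus_0_r in H. exact H. }
  assert (L : is_lim_seq (fun K => C * (Rabs h / rho) ^ S K) (C * 0)).
  { apply (is_lim_seq_scal_l _ C 0). apply (is_lim_seq_incr_1 (fun K => (Rabs h / rho) ^ K)).
    apply is_lim_seq_geom. rewrite Rabs_pos_eq; lra. }
  pose proof (is_lim_seq_le _ _ (Rabs (f (x + h))) (C * 0) Hb (is_lim_seq_const _) L) as HL.
  simpl in HL. rewrite Rmult_0_r in HL.
  apply Rabs_eq_0. apply Rle_antisym; [easy|apply Rabs_pos].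
Qed.

(** Let s be the supremum of the positive points where f is nonzero. Then f vanishes to the right of
    s, hence near s, and s - d is a smaller upper bound. *)
Lemma identity_theorem (f : R -> R) :
  (forall x, 0 < x -> jet f x) -> (forall x, 1 < x -> f x = 0) -> forall x, 0 < x -> f x = 0.
Proof.
  intros Hj H1 x1 Hx1. apply NNPP. intros Hne.
  pose (E := fun x => 0 < x /\ f x <> 0).
  destruct (completeness E) as [s [Hub Hlub]].
  - exists 1. intros x [_ Hx]. apply Rnot_lt_le. intros Hlt. now apply Hx, H1.
  - exists x1. split; easy.
  - assert (Hs : 0 < s) by (apply Rlt_le_trans with x1; [easy|]; apply Hub; split; easy).
    destruct (jet_vanishing f s (Hj s Hs)) as [d [Hd Hz]].
    + intros y Hy. apply NNPP. intros Hfy. assert (y <= s) by (apply Hub; split; [lra|easy]). lra.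
    + assert (s <= s - d); [|lra]. apply Hlub. intros x [Hx Hfx].
      apply Rnot_lt_le. intros Hlt. apply Hfx, Hz.
      assert (x <= s) by (apply Hub; split; easy).
      apply Rabs_lt_between'. lra.
Qed.

(** * Taylor remainder of the exponential and telescoping bounds for series *)

Definition exp_poly (K : nat) (x : R) : R := sum_f_R0 (fun k => x ^ k / INR (fact k)) K.

Lemma is_derive_exp_poly (K : nat) (x : R) : is_derive (exp_poly (S K)) x (exp_poly K x).
Proof.
  assert (H : forall k y, is_derive (fun x => x ^ S k / INR (fact (S k))) y (y ^ k / INR (fact k))).
  { intros k y. pose proof (INR_fact_neq_0 k). pose proof (INR_fact_neq_0 (S k)).
    replace (y ^ k / INR (fact k)) with (INR (S k) * y ^ k / INR (fact (S k))).
    - set (c := INR (fact (S k))) in *. auto_derive; [easy|].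
      change (match k with O => 1 | S _ => INR k + 1 end) with (INR (S k)).
      simpl Nat.pred. field. easy.
    - rewrite fact_simpl, mult_INR. field. split; [easy|]. apply not_0_INR; lia. }
  unfold exp_poly. induction K as [|K IH].
  - apply (is_derive_ext (fun x => 1 + x ^ 1 / INR (fact 1))); [intros; simpl; field|].
    replace (sum_f_R0 (fun k => x ^ k / INR (fact k)) 0) with (0 + x ^ 0 / INR (fact 0)) by (simpl; field).
    apply (is_derive_plus (fun _ => 1)); [apply (@is_derive_const R_AbsRing R_NormedModule)|apply H].
  - rewrite (tech5 (fun k => x ^ k / INR (fact k)) K).
    apply (is_derive_plus (exp_poly (S K))); [exact IH|apply H].
Qed.

Lemma exp_poly_0 (K : nat) : exp_poly K 0 = 1.
Proof.
  unfold exp_poly. induction K as [|K IH]; [simpl; field|].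
  rewrite tech5, IH, pow_i by lia. unfold Rdiv. ring.
Qed.

(** Induction on K: the derivative of each remainder is the preceding one, and all remainders vanish
    at 0. *)
Lemma exp_remainder_bound (K : nat) (z : R) :
  Rabs (exp z - exp_poly K z) <= Rabs z ^ S K / INR (fact (S K)) * exp (Rabs z).
Proof.
  assert (step : forall (m : nat) (R1 R0 : R -> R), R1 0 = 0 ->
    (forall x, is_derive R1 x (R0 x)) ->
    (forall x, Rabs (R0 x) <= Rabs x ^ m / INR (fact m) * exp (Rabs x)) ->
    forall x, Rabs (R1 x) <= Rabs x ^ S m / INR (fact (S m)) * exp (Rabs x)).
  { intros m R1 R0 H0 Hd Hb x.
    pose proof (Rabs_pos x) as Hx. pose proof (INR_fact_lt_0 m) as Hm.
    (* Moving along s x with 0 <= s <= 1 treats both signs of x at once. *)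
    replace (R1 x) with (R1 (1 * x) - R1 (0 * x)) by (rewrite Rmult_0_l, H0, Rmult_1_l; ring).
    pose (B := Rabs x ^ S m / INR (fact m) * exp (Rabs x)).
    eapply Rle_trans.
    - apply (increment_bound (fun s => R1 (s * x)) (fun s => x * R0 (s * x))
        (fun s => B / INR (S m) * s ^ S m) (fun s => B * s ^ m)); [lra| | |].
      + intros s _. apply (is_derive_comp R1 (fun s => s * x)); [apply Hd|].
        auto_derive; [easy|ring].
      + intros s _. auto_derive; [easy|].
        change (match m with O => 1 | S _ => INR m + 1 end) with (INR (S m)).
        simpl Nat.pred. field. apply not_0_INR; lia.
      + intros s Hs. rewrite Rabs_mult.
        eapply Rle_trans; [apply Rmult_le_compat_l; [easy|apply Hb]|].
        rewrite Rabs_mult, (Rabs_pos_eq s) by lra. unfold B.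
        replace (Rabs x * ((s * Rabs x) ^ m / INR (fact m) * exp (s * Rabs x)))
          with (Rabs x ^ S m * s ^ m / INR (fact m) * exp (s * Rabs x))
          by (rewrite Rpow_mult_distr; simpl; field; lra).
        replace (Rabs x ^ S m / INR (fact m) * exp (Rabs x) * s ^ m)
          with (Rabs x ^ S m * s ^ m / INR (fact m) * exp (Rabs x)) by (field; lra).
        apply Rmult_le_compat_l; [|apply exp_le; nra].
        apply Rmult_le_pos; [|left; now apply Rinv_0_lt_compat].
        apply Rmult_le_pos; apply pow_le; lra.
    - right. cbv beta. rewrite pow1, (pow_i (S m)) by lia. unfold B.
      rewrite fact_simpl, mult_INR. field. split; [lra|]. apply not_0_INR; lia. }
  revert z. induction K as [|K IH]; intros z.
  - apply (step O (fun x => exp x - exp_poly 0 x) exp).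
    + rewrite exp_0, exp_poly_0. ring.
    + intros x. apply (is_derive_ext (fun x => exp x - 1)); [intros; unfold exp_poly; simpl; field|].
      auto_derive; [easy|ring].
    + intros x. rewrite Rabs_pos_eq by (left; apply exp_pos). simpl.
      replace (1 / 1 * exp (Rabs x)) with (exp (Rabs x)) by field. apply exp_le, Rle_abs.
  - apply (step (S K) (fun x => exp x - exp_poly (S K) x) (fun x => exp x - exp_poly K x)).
    + rewrite exp_0, exp_poly_0. ring.
    + intros x. apply (is_derive_minus exp); [apply is_derive_exp|apply is_derive_exp_poly].
    + exact IH.
Qed.

Lemma pow_div_fact_le_exp (x : R) (k : nat) : 0 <= x -> x ^ k / INR (fact k) <= exp x.
Proof.
  intros Hx. eapply Rle_trans; [|apply (exp_ge_taylor x k Hx)].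
  assert (Hpos : forall j, 0 <= x ^ j / INR (fact j)).
  { intros j. apply Rmult_le_pos; [now apply pow_le|left; apply Rinv_0_lt_compat, INR_fact_lt_0]. }
  destruct k as [|k]; [apply Rle_refl|]. rewrite tech5.
  pose proof (cond_pos_sum _ k Hpos). lra.
Qed.

Lemma is_series_R_iff (u : nat -> R) (l : R) :
  is_series u l <-> is_lim_seq (sum_f_R0 u) l.
Proof.
  split; intros H.
  - apply (is_lim_seq_ext (sum_n u)); [apply sum_n_Reals|exact H].
  - apply (is_lim_seq_ext (sum_f_R0 u) (sum_n u) l) in H; [exact H|].
    intros; symmetry; apply sum_n_Reals.
Qed.

(** A telescoping majorant gives convergence, size and rate together. It serves with b n = (n +
    1)^(-a) for the remainder of zeta and with b n = q^n for power series. *)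
Lemma series_telescoping_bound (u b : nat -> R) (B : R) :
  is_lim_seq b 0 -> (forall n, Rabs (u n) <= B * (b n - b (S n))) ->
  ex_series u /\ Rabs (Series u) <= B * b O /\
  forall N, Rabs (Series u - sum_f_R0 u N) <= B * b (S N).
Proof.
  intros Hb Hu.
  assert (Htel : forall N, sum_f_R0 (fun n => B * (b n - b (S n))) N = B * (b O - b (S N))).
  { induction N as [|N IH]; [easy|]. rewrite tech5, IH. ring. }
  assert (Hser : is_series (fun n => B * (b n - b (S n))) (B * (b O - 0))).
  { apply is_series_R_iff. apply (is_lim_seq_ext (fun N => B * (b O - b (S N)))); [now intros; rewrite Htel|].
    apply (is_lim_seq_scal_l _ B (b O - 0)).
    apply is_lim_seq_minus'; [apply is_lim_seq_const|]. now apply (is_lim_seq_incr_1 b). }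
  assert (Hex : ex_series u).
  { apply (ex_series_le u (fun n => B * (b n - b (S n)))); [exact Hu|]. eexists; exact Hser. }
  assert (Hlim := Series_correct u Hex). apply is_series_R_iff in Hlim.
  assert (Hdiff : forall N M, Rabs (sum_f_R0 u (N + M) - sum_f_R0 u N) <= B * (b (S N) - b (S (N + M)))).
  { intros N M. induction M as [|M IH].
    - rewrite Nat.add_0_r. unfold Rminus. rewrite !Rplus_opp_r, Rabs_R0. lra.
    - rewrite Nat.add_succ_r, tech5. specialize (Hu (S (N + M))).
      replace (sum_f_R0 u (N + M) + u (S (N + M)) - sum_f_R0 u N)
        with ((sum_f_R0 u (N + M) - sum_f_R0 u N) + u (S (N + M))) by ring.
      eapply Rle_trans; [apply Rabs_triang|]. lra. }
  assert (Htail : forall N, Rabs (Series u - sum_f_R0 u N) <= B * b (S N)).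
  { intros N.
    assert (L1 : is_lim_seq (fun M => Rabs (sum_f_R0 u (N + M) - sum_f_R0 u N))
        (Rabs (Series u - sum_f_R0 u N))).
    { apply (is_lim_seq_abs _ (Series u - sum_f_R0 u N)).
      apply is_lim_seq_minus'; [|apply is_lim_seq_const].
      apply (is_lim_seq_ext (fun M => sum_f_R0 u (M + N))); [intros; now rewrite Nat.add_comm|].
      now apply (is_lim_seq_incr_n (sum_f_R0 u)). }
    assert (L2 : is_lim_seq (fun M => B * (b (S N) - b (S (N + M)))) (B * (b (S N) - 0))).
    { apply (is_lim_seq_scal_l _ B (b (S N) - 0)).
      apply is_lim_seq_minus'; [apply is_lim_seq_const|].
      apply (is_lim_seq_ext (fun M => b (M + S N)%nat)); [intros; f_equal; lia|].
      now apply (is_lim_seq_incr_n b). }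
    rewrite Rminus_0_r in L2.
    apply (is_lim_seq_le _ _ (Rabs (Series u - sum_f_R0 u N)) (B * b (S N)) (Hdiff N) L1 L2). }
  split; [easy|]. split; [|easy].
  specialize (Htail O). specialize (Hu O). simpl in Htail.
  replace (Series u) with ((Series u - u O) + u O) by ring.
  eapply Rle_trans; [apply Rabs_triang|]. lra.
Qed.

(** * The remainder series of zeta as a function of sigma *)

Definition power_seq (a : R) (n : nat) : R := exp (- (a * ln (INR (S n)))).

Lemma INR_S_ge_1 (n : nat) : 1 <= INR (S n).
Proof. rewrite S_INR. pose proof (pos_INR n). lra. Qed.

Lemma ln_INR_S_nonneg (n : nat) : 0 <= ln (INR (S n)).
Proof. rewrite <- ln_1. apply ln_le; [lra|apply INR_S_ge_1]. Qed.

Lemma is_lim_power_seq (a : R) : 0 < a -> is_lim_seq (power_seq a) 0.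
Proof.
  intros Ha. unfold power_seq.
  apply (is_lim_seq_incr_1 (fun n => exp (- (a * ln (INR n))))).
  apply (is_lim_comp_seq (fun x => exp (- (a * ln x))) INR p_infty 0); [| |apply is_lim_seq_INR].
  - apply (is_lim_comp (fun y => exp (- (a * y))) ln p_infty 0 p_infty);
      [now apply is_lim_exp_neg_mult|apply is_lim_ln_p|exists 0; easy].
  - exists O; easy.
Qed.

(** The integral of y^(-a-1) over [n + 1, n + 2] is a difference of consecutive values of y^(-a),
    divided by a: the shape that [series_telescoping_bound] expects. *)
Lemma RInt_power_bound (f : R -> R) (a B : R) (n : nat) : 0 < a -> 0 <= B ->
  (forall y, 0 < y -> continuous f y) ->
  (forall y, INR (S n) <= y <= INR (S (S n)) -> Rabs (f y) <= B * exp (- ((a + 1) * ln y))) ->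
  Rabs (RInt f (INR (S n)) (INR (S (S n)))) <= B / a * (power_seq a n - power_seq a (S n)).
Proof.
  intros Ha HB Hc Hb.
  pose proof (INR_S_ge_1 n) as H1. assert (H2 : INR (S n) <= INR (S (S n))) by (rewrite (S_INR (S n)); lra).
  set (p := INR (S n)) in *. set (q := INR (S (S n))) in *.
  assert (Hex : ex_RInt f p q).
  { apply (@ex_RInt_continuous R_CompleteNormedModule). rewrite Rmin_left, Rmax_right by lra.
    intros y Hy. apply Hc. lra. }
  assert (Hg : is_RInt (fun y => B * exp (- ((a + 1) * ln y))) p q
     (- (B / a * exp (- (a * ln q))) - - (B / a * exp (- (a * ln p))))).
  { apply (is_RInt_derive (fun y => - (B / a * exp (- (a * ln y))))).
    - rewrite Rmin_left, Rmax_right by lra. intros y Hy. auto_derive; [lra|].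
      replace (- ((a + 1) * ln y)) with (- (a * ln y) + - ln y) by ring.
      rewrite exp_plus, exp_Ropp, (exp_Ropp (ln y)), exp_ln by lra.
      field. repeat split; try lra. apply Rgt_not_eq, exp_pos.
    - rewrite Rmin_left, Rmax_right by lra. intros y Hy.
      apply (@ex_derive_continuous R_AbsRing R_NormedModule). auto_derive. lra. }
  eapply Rle_trans; [apply abs_RInt_le; [easy|exact Hex]|].
  replace (B / a * (power_seq a n - power_seq a (S n)))
    with (RInt (fun y => B * exp (- ((a + 1) * ln y))) p q).
  - apply RInt_le; [easy| | |].
    + apply (ex_RInt_norm f). exact Hex.
    + eexists; exact Hg.
    + intros y Hy. apply Hb. lra.
  - unfold power_seq. fold p q.
    refine (eq_trans (is_RInt_unique _ _ _ _ Hg) _).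
    ring_in_R.
Qed.

(* The integrand {y} y^(-s-1) of the Euler-Maclaurin remainder of zeta on [m + 1, m + 2]; the weight
   [w] is the real or imaginary part of y^(-iv), up to sign. *)
Definition frac_integrand (w : R -> R) (m : nat) (sigma y : R) : R :=
  w y * (y - INR (S m)) * exp (- ((sigma + 1) * ln y)).

Definition frac_integral (w : R -> R) (sigma : R) (m : nat) : R :=
  RInt (frac_integrand w m sigma) (INR (S m)) (INR (S (S m))).

Definition frac_series (w : R -> R) (sigma : R) : R := Series (frac_integral w sigma).

(** All that is used of cos (v ln y) and sin (v ln y) in the convergence and jet arguments, so that
    real and imaginary parts share them. *)
Definition bounded_weight (w : R -> R) : Prop :=
  (forall y, Rabs (w y) <= 1) /\ (forall y, 0 < y -> continuous w y).

Lemma continuous_weighted (w g : R -> R) (y : R) : bounded_weight w -> 0 < y ->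
  ex_derive g y -> continuous (fun y => w y * g y) y.
Proof.
  intros [_ Hw] Hy Hg. apply (continuous_mult w g); [now apply Hw|].
  now apply (@ex_derive_continuous R_AbsRing R_NormedModule).
Qed.

Lemma continuous_frac_integrand (w : R -> R) (m : nat) (sigma y : R) : bounded_weight w -> 0 < y ->
  continuous (frac_integrand w m sigma) y.
Proof.
  intros Hw Hy.
  apply (continuous_ext (fun y => w y * ((y - INR (S m)) * exp (- ((sigma + 1) * ln y))))).
  - intros; unfold frac_integrand; ring_in_R.
  - apply continuous_weighted; [easy|easy|]. auto_derive; easy.
Qed.

Lemma Rabs_weight_le (w : R -> R) (m : nat) (y z B : R) : bounded_weight w ->
  INR (S m) <= y <= INR (S (S m)) -> Rabs z <= B -> Rabs (w y * (y - INR (S m)) * z) <= B.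
Proof.
  intros [Hw _] Hy Hz. rewrite (S_INR (S m)) in Hy. rewrite !Rabs_mult, (Rabs_pos_eq (y - _)) by lra.
  specialize (Hw y). pose proof (Rabs_pos (w y)). pose proof (Rabs_pos z).
  assert (Rabs (w y) * (y - INR (S m)) <= 1) by nra.
  assert (0 <= Rabs (w y) * (y - INR (S m))) by nra. nra.
Qed.

Lemma frac_integral_bound (w : R -> R) (sigma : R) (m : nat) : bounded_weight w -> 0 < sigma ->
  Rabs (frac_integral w sigma m) <= 1 / sigma * (power_seq sigma m - power_seq sigma (S m)).
Proof.
  intros Hw Hs. apply RInt_power_bound; [easy|lra| |].
  - intros y Hy. now apply continuous_frac_integrand.
  - intros y Hy. apply Rabs_weight_le; [easy|easy|].
    rewrite Rabs_pos_eq by (left; apply exp_pos). lra.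
Qed.

Lemma frac_series_tail (w : R -> R) (sigma : R) (N : nat) : bounded_weight w -> 0 < sigma ->
  Rabs (frac_series w sigma - sum_f_R0 (frac_integral w sigma) N) <= 1 / sigma * power_seq sigma (S N).
Proof.
  intros Hw Hs.
  apply (series_telescoping_bound (frac_integral w sigma) (power_seq sigma) (1 / sigma)).
  - now apply is_lim_power_seq.
  - intros n. now apply frac_integral_bound.
Qed.

Lemma ex_frac_series (w : R -> R) (sigma : R) : bounded_weight w -> 0 < sigma ->
  ex_series (frac_integral w sigma).
Proof.
  intros Hw Hs.
  apply (series_telescoping_bound (frac_integral w sigma) (power_seq sigma) (1 / sigma)).
  - now apply is_lim_power_seq.
  - intros n. now apply frac_integral_bound.
Qed.

(** The coefficient of h^k in the integrand at sigma + h, from y^(-h) = sum_k (- ln y)^k h^k /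
    k!. *)
Definition frac_coef_integrand (w : R -> R) (m : nat) (sigma : R) (k : nat) (y : R) : R :=
  w y * (y - INR (S m)) * (exp (- ((sigma + 1) * ln y)) * ((- ln y) ^ k / INR (fact k))).

Definition frac_coef (w : R -> R) (sigma : R) (k m : nat) : R :=
  RInt (frac_coef_integrand w m sigma k) (INR (S m)) (INR (S (S m))).

Lemma continuous_frac_coef_integrand (w : R -> R) (m : nat) (sigma : R) (k : nat) (y : R) :
  bounded_weight w -> 0 < y -> continuous (frac_coef_integrand w m sigma k) y.
Proof.
  intros Hw Hy.
  apply (continuous_ext (fun y => w y * ((y - INR (S m)) *
    (exp (- ((sigma + 1) * ln y)) * ((- ln y) ^ k / INR (fact k)))))).
  - intros; unfold frac_coef_integrand; ring_in_R.
  - apply continuous_weighted; [easy|easy|]. auto_derive. easy.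
Qed.

(** The power of the logarithm costs half of the decay: (sigma / 2 * ln y)^k / k! <= y^(sigma /
    2). *)
Lemma frac_coef_bound (w : R -> R) (sigma : R) (k m : nat) : bounded_weight w -> 0 < sigma ->
  Rabs (frac_coef w sigma k m)
  <= / (sigma / 2) ^ k / (sigma / 2) * (power_seq (sigma / 2) m - power_seq (sigma / 2) (S m)).
Proof.
  intros Hw Hs. assert (Hp : 0 < (sigma / 2) ^ k) by (apply pow_lt; lra).
  apply RInt_power_bound; [lra|left; now apply Rinv_0_lt_compat| |].
  - intros y Hy. now apply continuous_frac_coef_integrand.
  - intros y Hy. apply Rabs_weight_le; [easy|easy|].
    assert (HL : 0 <= ln y) by (rewrite <- ln_1; apply ln_le; pose proof (INR_S_ge_1 m); lra).
    unfold Rdiv. rewrite !Rabs_mult, <- RPow_abs, Rabs_Ropp, (Rabs_pos_eq (ln y)) by easy.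
    rewrite (Rabs_pos_eq (exp _)) by (left; apply exp_pos).
    rewrite (Rabs_pos_eq (/ _)) by (left; apply Rinv_0_lt_compat, INR_fact_lt_0).
    apply Rmult_le_reg_l with ((sigma / 2) ^ k); [easy|].
    rewrite <- (Rmult_assoc _ (/ _) (exp _)), Rinv_r, Rmult_1_l by lra.
    replace ((sigma / 2) ^ k * (exp (- ((sigma + 1) * ln y)) * (ln y ^ k * / INR (fact k))))
      with (exp (- ((sigma + 1) * ln y)) * ((sigma / 2 * ln y) ^ k / INR (fact k)))
      by (rewrite Rpow_mult_distr; unfold Rdiv; ring).
    replace (- ((sigma * / 2 + 1) * ln y)) with (- ((sigma + 1) * ln y) + sigma / 2 * ln y) by field.
    rewrite exp_plus. apply Rmult_le_compat_l; [left; apply exp_pos|].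
    apply pow_div_fact_le_exp. nra.
Qed.

Lemma ex_series_frac_coef (w : R -> R) (sigma : R) (k : nat) : bounded_weight w -> 0 < sigma ->
  ex_series (frac_coef w sigma k).
Proof.
  intros Hw Hs.
  apply (series_telescoping_bound _ (power_seq (sigma / 2)) (/ (sigma / 2) ^ k / (sigma / 2))).
  - apply is_lim_power_seq; lra.
  - intros n. now apply frac_coef_bound.
Qed.

(** Put r = |h| / (sigma / 4) and L = ln y. In the Taylor remainder of exp (- h L), both (sigma L /
    4)^(K+1) / (K+1)! and exp (r sigma L / 4) are at most y^(sigma / 4). The factor r^(K+1) remains,
    and the decay drops from y^(-sigma-1) to y^(-sigma/2-1). *)
Lemma frac_integral_taylor (w : R -> R) (sigma : R) (K m : nat) (h : R) :
  bounded_weight w -> 0 < sigma -> Rabs h < sigma / 4 ->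
  Rabs (frac_integral w (sigma + h) m - sum_f_R0 (fun k => frac_coef w sigma k m * h ^ k) K)
  <= (Rabs h / (sigma / 4)) ^ S K / (sigma / 2) * (power_seq (sigma / 2) m - power_seq (sigma / 2) (S m)).
Proof.
  intros Hw Hs Hh.
  pose proof (INR_S_ge_1 m) as H1.
  assert (H2 : INR (S m) <= INR (S (S m))) by (rewrite (S_INR (S m)); lra).
  pose (F := fun y => frac_integrand w m (sigma + h) y
      - sum_f_R0 (fun k => frac_coef_integrand w m sigma k y * h ^ k) K).
  assert (Hint : forall f : R -> R, (forall y, 0 < y -> continuous f y) ->
    is_RInt f (INR (S m)) (INR (S (S m))) (RInt f (INR (S m)) (INR (S (S m))))).
  { intros f Hf. apply (@RInt_correct R_CompleteNormedModule), (@ex_RInt_continuous R_CompleteNormedModule).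
    rewrite Rmin_left, Rmax_right by lra. intros y Hy. apply Hf. lra. }
  assert (HF : is_RInt F (INR (S m)) (INR (S (S m)))
    (frac_integral w (sigma + h) m - sum_f_R0 (fun k => frac_coef w sigma k m * h ^ k) K)).
  { apply (is_RInt_minus (frac_integrand w m (sigma + h))).
    - apply Hint. intros; now apply continuous_frac_integrand.
    - assert (Hk : forall k, is_RInt (fun y => frac_coef_integrand w m sigma k y * h ^ k)
         (INR (S m)) (INR (S (S m))) (frac_coef w sigma k m * h ^ k)).
      { intros k. rewrite Rmult_comm.
        apply (is_RInt_ext (fun y => scal (h ^ k) (frac_coef_integrand w m sigma k y)));
          [intros; apply Rmult_comm|].
        apply (is_RInt_scal (frac_coef_integrand w m sigma k)), Hint.
        intros; now apply continuous_frac_coef_integrand. }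
      clear F. induction K as [|K IH]; [apply Hk|].
      apply (is_RInt_plus (fun y => sum_f_R0 (fun k => frac_coef_integrand w m sigma k y * h ^ k) K));
        [exact IH|apply Hk]. }
  rewrite <- (is_RInt_unique _ _ _ _ HF).
  assert (HFeq : forall y, F y = w y * (y - INR (S m)) *
     (exp (- ((sigma + 1) * ln y)) * (exp (- (h * ln y)) - exp_poly K (- (h * ln y))))).
  { intros y. unfold F, frac_integrand.
    replace (exp (- ((sigma + h + 1) * ln y))) with (exp (- ((sigma + 1) * ln y)) * exp (- (h * ln y)))
      by (rewrite <- exp_plus; f_equal; ring).
    replace (sum_f_R0 (fun k => frac_coef_integrand w m sigma k y * h ^ k) K)
      with (w y * (y - INR (S m)) * exp (- ((sigma + 1) * ln y)) * exp_poly K (- (h * ln y))); [ring|].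
    unfold exp_poly. rewrite scal_sum. apply sum_eq. intros k _.
    unfold frac_coef_integrand. replace (- (h * ln y)) with ((- ln y) * h) by ring.
    rewrite Rpow_mult_distr. unfold Rdiv. ring. }
  apply RInt_power_bound; [lra|apply pow_le, ratio_bounds; lra| |].
  - intros y Hy. unfold F. apply (continuous_minus (frac_integrand w m (sigma + h))).
    + now apply continuous_frac_integrand.
    + clear F HF HFeq. induction K as [|K IH]; simpl.
      * apply (continuous_mult (frac_coef_integrand w m sigma 0) (fun _ => 1));
          [now apply continuous_frac_coef_integrand|apply continuous_const].
      * apply (continuous_plus (fun y => sum_f_R0 (fun k => frac_coef_integrand w m sigma k y * h ^ k) K));
          [exact IH|].
        apply (continuous_mult (frac_coef_integrand w m sigma (S K)) (fun _ => h * h ^ K));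
          [now apply continuous_frac_coef_integrand|apply continuous_const].
  - intros y Hy. rewrite HFeq. apply Rabs_weight_le; [easy|easy|].
    assert (HL : 0 <= ln y) by (rewrite <- ln_1; apply ln_le; lra).
    set (L := ln y) in *.
    rewrite Rabs_mult, (Rabs_pos_eq (exp _)) by (left; apply exp_pos).
    eapply Rle_trans.
    { apply Rmult_le_compat_l; [left; apply exp_pos|apply exp_remainder_bound]. }
    rewrite Rabs_Ropp, Rabs_mult, (Rabs_pos_eq L) by easy.
    replace (Rabs h * L) with (Rabs h / (sigma / 4) * (sigma / 4 * L)) by (field; lra).
    pose proof (ratio_bounds h (sigma / 4) Hh) as Hr. set (r := Rabs h / (sigma / 4)) in *.
    rewrite Rpow_mult_distr.
    replace (- ((sigma / 2 + 1) * L)) with (- ((sigma + 1) * L) + (sigma / 4 * L + sigma / 4 * L)) by field.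
    rewrite !exp_plus.
    assert (A1 := pow_div_fact_le_exp (sigma / 4 * L) (S K) ltac:(nra)).
    assert (A2 : exp (r * (sigma / 4 * L)) <= exp (sigma / 4 * L)).
    { apply exp_le. assert (0 <= sigma / 4 * L) by nra. nra. }
    assert (A3 : 0 <= (sigma / 4 * L) ^ S K / INR (fact (S K))).
    { apply Rmult_le_pos; [apply pow_le; nra|left; apply Rinv_0_lt_compat, INR_fact_lt_0]. }
    assert (A4 := Rmult_le_compat _ _ _ _ A3 (Rlt_le _ _ (exp_pos (r * (sigma / 4 * L)))) A1 A2).
    replace (exp (- ((sigma + 1) * L)) * (r ^ S K * (sigma / 4 * L) ^ S K / INR (fact (S K)) * exp (r * (sigma / 4 * L))))
      with (r ^ S K * (exp (- ((sigma + 1) * L)) * ((sigma / 4 * L) ^ S K / INR (fact (S K)) * exp (r * (sigma / 4 * L)))))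
      by (unfold Rdiv; ring).
    apply Rmult_le_compat_l; [apply pow_le; lra|].
    apply Rmult_le_compat_l; [left; apply exp_pos|exact A4].
Qed.

(** The bounds of [frac_integral_taylor] telescope over m with a factor independent of m, and
    [power_seq] equals 1 at index 0. *)
Lemma jet_frac_series (w : R -> R) (sigma : R) : bounded_weight w -> 0 < sigma ->
  jet (frac_series w) sigma.
Proof.
  intros Hw Hs.
  exists (fun k => Series (frac_coef w sigma k)), (/ (sigma / 2)), (sigma / 4).
  split; [lra|]. intros K h Hh.
  pose (u := fun m => frac_integral w (sigma + h) m - sum_f_R0 (fun k => frac_coef w sigma k m * h ^ k) K).
  assert (Hpos : 0 < sigma + h) by (apply Rabs_lt_between in Hh; lra).
  assert (Hu : is_series u (frac_series w (sigma + h) - poly_sum (fun k => Series (frac_coef w sigma k)) K h)).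
  { apply (is_series_minus (frac_integral w (sigma + h))).
    - now apply Series_correct, ex_frac_series.
    - assert (Hk : forall k, is_series (fun m => frac_coef w sigma k m * h ^ k) (Series (frac_coef w sigma k) * h ^ k)).
      { intros k. apply (is_series_scal_r (h ^ k)). now apply Series_correct, ex_series_frac_coef. }
      clear u. unfold poly_sum. induction K as [|K IH]; [apply Hk|].
      apply (is_series_plus (fun m => sum_f_R0 (fun k => frac_coef w sigma k m * h ^ k) K)); [exact IH|apply Hk]. }
  rewrite <- (is_series_unique _ _ Hu).
  destruct (series_telescoping_bound u (power_seq (sigma / 2)) ((Rabs h / (sigma / 4)) ^ S K / (sigma / 2)))
    as [_ [H _]].
  - apply is_lim_power_seq; lra.
  - intros m. now apply frac_integral_taylor.
  - eapply Rle_trans; [exact H|]. unfold power_seq. simpl INR. rewrite ln_1, Rmult_0_r, Ropp_0, exp_0.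
    right. unfold Rdiv. ring.
Qed.

(** * Partial sums of the Dirichlet series *)

(** At s = sigma + iv, y^(-s) = [cos_power] - i [sin_power]; the minus sign is kept outside. *)
Definition cos_power (sigma v y : R) : R := exp (- (sigma * ln y)) * cos (v * ln y).
Definition sin_power (sigma v y : R) : R := exp (- (sigma * ln y)) * sin (v * ln y).

Definition cos_ln (v y : R) : R := cos (v * ln y).
Definition sin_ln (v y : R) : R := sin (v * ln y).

Lemma bounded_weight_cos_ln (v : R) : bounded_weight (cos_ln v).
Proof.
  split; [intros; apply Rabs_cos_le|]. intros y Hy.
  apply (@ex_derive_continuous R_AbsRing R_NormedModule). unfold cos_ln. auto_derive. lra.
Qed.

Lemma bounded_weight_sin_ln (v : R) : bounded_weight (sin_ln v).
Proof.
  split; [intros; apply Rabs_sin_le|]. intros y Hy.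
  apply (@ex_derive_continuous R_AbsRing R_NormedModule). unfold sin_ln. auto_derive. lra.
Qed.

(* Real and imaginary parts of s (1 - s). *)
Definition quad_re (sigma v : R) : R := sigma - sigma ^ 2 + v ^ 2.
Definition quad_im (sigma v : R) : R := v * (1 - 2 * sigma).

Lemma is_RInt_frac_integral (w : R -> R) (sigma : R) (m : nat) : bounded_weight w ->
  is_RInt (frac_integrand w m sigma) (INR (S m)) (INR (S (S m))) (frac_integral w sigma m).
Proof.
  intros Hw. pose proof (INR_S_ge_1 m).
  apply (@RInt_correct R_CompleteNormedModule), (@ex_RInt_continuous R_CompleteNormedModule).
  rewrite Rmin_left, Rmax_right by (rewrite (S_INR (S m)); lra).
  intros y Hy. apply continuous_frac_integrand; [easy|lra].
Qed.

(** The same integral evaluated by a primitive and by linearity. Exhibiting [H] takes the place of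
    an integration by parts. *)
Lemma frac_integral_combination (sigma v al be : R) (m : nat) (H : R -> R) :
  (forall y, 0 < y -> is_derive H y
     ((y - INR (S m)) * ((al * cos (v * ln y) + be * sin (v * ln y)) * exp (- ((sigma + 1) * ln y))))) ->
  H (INR (S (S m))) - H (INR (S m))
  = al * frac_integral (cos_ln v) sigma m + be * frac_integral (sin_ln v) sigma m.
Proof.
  intros Hd. pose proof (INR_S_ge_1 m).
  assert (I1 : is_RInt (fun y => (y - INR (S m)) * ((al * cos (v * ln y) + be * sin (v * ln y)) * exp (- ((sigma + 1) * ln y))))
     (INR (S m)) (INR (S (S m))) (H (INR (S (S m))) - H (INR (S m)))).
  { apply (is_RInt_derive H).
    - rewrite Rmin_left, Rmax_right by (rewrite (S_INR (S m)); lra). intros y Hy. apply Hd; lra.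
    - rewrite Rmin_left, Rmax_right by (rewrite (S_INR (S m)); lra). intros y Hy.
      apply (@ex_derive_continuous R_AbsRing R_NormedModule). auto_derive. repeat split; lra. }
  assert (I2 : is_RInt (fun y => (y - INR (S m)) * ((al * cos (v * ln y) + be * sin (v * ln y)) * exp (- ((sigma + 1) * ln y))))
     (INR (S m)) (INR (S (S m)))
     (al * frac_integral (cos_ln v) sigma m + be * frac_integral (sin_ln v) sigma m)).
  { apply (is_RInt_ext (fun y => plus (scal al (frac_integrand (cos_ln v) m sigma y))
                                      (scal be (frac_integrand (sin_ln v) m sigma y)))).
    - intros y _. unfold frac_integrand, cos_ln, sin_ln, plus, scal; simpl; unfold mult; simpl. ring_in_R.
    - apply (is_RInt_plus (fun y => scal al (frac_integrand (cos_ln v) m sigma y)));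
      apply (is_RInt_scal (V := R_NormedModule)); apply is_RInt_frac_integral;
        [apply bounded_weight_cos_ln|apply bounded_weight_sin_ln]. }
  exact (eq_trans (eq_sym (is_RInt_unique _ _ _ _ I1)) (is_RInt_unique _ _ _ _ I2)).
Qed.

(* Real and imaginary parts of (1 - s) sum_(n <= N + 1) n^-s - (N + 1)^(1 - s) at s = sigma + iv. *)
Definition partial_zeta_re (sigma v : R) (N : nat) : R :=
  (1 - sigma) * sum_f_R0 (fun k => cos_power sigma v (INR (S k))) N
  - v * sum_f_R0 (fun k => sin_power sigma v (INR (S k))) N
  - INR (S N) * cos_power sigma v (INR (S N)).

Definition partial_zeta_im (sigma v : R) (N : nat) : R :=
  - (1 - sigma) * sum_f_R0 (fun k => sin_power sigma v (INR (S k))) N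
  - v * sum_f_R0 (fun k => cos_power sigma v (INR (S k))) N
  + INR (S N) * sin_power sigma v (INR (S N)).

Lemma cos_power_1 (sigma v : R) : cos_power sigma v 1 = 1.
Proof. unfold cos_power. rewrite ln_1, !Rmult_0_r, Ropp_0, exp_0, cos_0. ring. Qed.

Lemma sin_power_1 (sigma v : R) : sin_power sigma v 1 = 0.
Proof. unfold sin_power. rewrite ln_1, !Rmult_0_r, Ropp_0, exp_0, sin_0. ring. Qed.

Lemma power_shift (sigma y : R) : 0 < y ->
  exp (- (sigma * ln y)) = y * exp (- ((sigma + 1) * ln y)).
Proof.
  intros Hy. rewrite <- (exp_ln y Hy) at 2. rewrite <- exp_plus. f_equal. ring.
Qed.

(** With m = N + 1, [H] is the real part of (y - m) (1 - s) y^(-s) - y^(1-s). Its increment over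
    [m, m + 1] is the step of the partial sums, and its derivative is the real part of - s (1 - s)
    (y - m) y^(-s-1). *)
Lemma partial_zeta_re_step (sigma v : R) (N : nat) :
  partial_zeta_re sigma v (S N) - partial_zeta_re sigma v N
  = - (quad_re sigma v * frac_integral (cos_ln v) sigma N
       + quad_im sigma v * frac_integral (sin_ln v) sigma N).
Proof.
  pose (H := fun y => (y - INR (S N)) * ((1 - sigma) * cos_power sigma v y - v * sin_power sigma v y)
                      - y * cos_power sigma v y).
  transitivity (H (INR (S (S N))) - H (INR (S N))).
  - unfold partial_zeta_re, H. rewrite !tech5, (S_INR (S N)). ring.
  - rewrite (frac_integral_combination sigma v (- quad_re sigma v) (- quad_im sigma v)); [ring|].
    intros y Hy. unfold H, quad_re, quad_im, cos_power, sin_power. set (m := INR (S N)).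
    auto_derive; [repeat split; lra|].
    rewrite (power_shift sigma y Hy). field. lra.
Qed.

Lemma partial_zeta_im_step (sigma v : R) (N : nat) :
  partial_zeta_im sigma v (S N) - partial_zeta_im sigma v N
  = - (quad_im sigma v * frac_integral (cos_ln v) sigma N
       - quad_re sigma v * frac_integral (sin_ln v) sigma N).
Proof.
  pose (H := fun y => (y - INR (S N)) * (- (1 - sigma) * sin_power sigma v y - v * cos_power sigma v y)
                      + y * sin_power sigma v y).
  transitivity (H (INR (S (S N))) - H (INR (S N))).
  - unfold partial_zeta_im, H. rewrite !tech5, (S_INR (S N)). ring.
  - rewrite (frac_integral_combination sigma v (- quad_im sigma v) (quad_re sigma v)); [ring|].
    intros y Hy. unfold H, quad_re, quad_im, cos_power, sin_power. set (m := INR (S N)).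
    auto_derive; [repeat split; lra|].
    rewrite (power_shift sigma y Hy). field. lra.
Qed.

Lemma partial_zeta_re_eq (sigma v : R) (N : nat) :
  partial_zeta_re sigma v (S N)
  = - sigma - (quad_re sigma v * sum_f_R0 (frac_integral (cos_ln v) sigma) N
               + quad_im sigma v * sum_f_R0 (frac_integral (sin_ln v) sigma) N).
Proof.
  induction N as [|N IH].
  - assert (E : partial_zeta_re sigma v 0 = - sigma).
    { unfold partial_zeta_re. simpl. rewrite cos_power_1, sin_power_1. ring. }
    pose proof (partial_zeta_re_step sigma v 0). simpl sum_f_R0. lra.
  - pose proof (partial_zeta_re_step sigma v (S N)). rewrite !tech5. lra.
Qed.

Lemma partial_zeta_im_eq (sigma v : R) (N : nat) :
  partial_zeta_im sigma v (S N)
  = - v - (quad_im sigma v * sum_f_R0 (frac_integral (cos_ln v) sigma) N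
               - quad_re sigma v * sum_f_R0 (frac_integral (sin_ln v) sigma) N).
Proof.
  induction N as [|N IH].
  - assert (E : partial_zeta_im sigma v 0 = - v).
    { unfold partial_zeta_im. simpl. rewrite cos_power_1, sin_power_1. ring. }
    pose proof (partial_zeta_im_step sigma v 0). simpl sum_f_R0. lra.
  - pose proof (partial_zeta_im_step sigma v (S N)). rewrite !tech5. lra.
Qed.

Lemma is_lim_frac_partial_sums (w : R -> R) (sigma : R) : bounded_weight w -> 0 < sigma ->
  is_lim_seq (sum_f_R0 (frac_integral w sigma)) (frac_series w sigma).
Proof. intros Hw Hs. apply is_series_R_iff, Series_correct. now apply ex_frac_series. Qed.

Lemma is_lim_mult_power (g : R -> R) (sigma : R) : 1 < sigma -> (forall y, Rabs (g y) <= 1) ->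
  is_lim_seq (fun N => INR (S N) * (exp (- (sigma * ln (INR (S N)))) * g (INR (S N)))) 0.
Proof.
  intros Hs Hg. apply is_lim_seq_abs_0.
  apply (is_lim_seq_le_le (fun _ => 0) _ (power_seq (sigma - 1))).
  - intros n. split; [apply Rabs_pos|]. pose proof (INR_S_ge_1 n).
    unfold power_seq. set (y := INR (S n)) in *.
    rewrite !Rabs_mult, (Rabs_pos_eq y), (Rabs_pos_eq (exp _)) by (try lra; left; apply exp_pos).
    rewrite (power_shift (sigma - 1)) by lra. replace (sigma - 1 + 1) with sigma by ring.
    rewrite <- Rmult_assoc. rewrite <- (Rmult_1_r (y * exp _)) at 2.
    apply Rmult_le_compat_l; [|apply Hg]. apply Rmult_le_pos; [lra|left; apply exp_pos].
  - apply is_lim_seq_const.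
  - apply is_lim_power_seq. lra.
Qed.

(** Real and imaginary parts of (1 - s) zeta(s) = - s - s (1 - s) int_1^oo {y} y^(-s-1) dy, obtained
    as N -> infinity; N^(1-s) tends to 0 because Re s > 1. *)
Lemma dirichlet_formula (sigma v zr zi : R) : 1 < sigma ->
  is_lim_seq (sum_f_R0 (fun k => cos_power sigma v (INR (S k)))) zr ->
  is_lim_seq (sum_f_R0 (fun k => - sin_power sigma v (INR (S k)))) zi ->
  (1 - sigma) * zr + v * zi = - sigma - (quad_re sigma v * frac_series (cos_ln v) sigma
               + quad_im sigma v * frac_series (sin_ln v) sigma)
  /\ (1 - sigma) * zi - v * zr = - v - (quad_im sigma v * frac_series (cos_ln v) sigma
               - quad_re sigma v * frac_series (sin_ln v) sigma).
Proof.
  intros Hs Hr Hi.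
  assert (Hi' : is_lim_seq (sum_f_R0 (fun k => sin_power sigma v (INR (S k)))) (- zi)).
  { apply (is_lim_seq_ext (fun N => - sum_f_R0 (fun k => - sin_power sigma v (INR (S k))) N)).
    - intros N. induction N as [|N IH]; simpl; [ring|]. simpl in IH. rewrite <- IH. ring.
    - now apply (is_lim_seq_opp _ zi). }
  assert (Tc := is_lim_frac_partial_sums (cos_ln v) sigma (bounded_weight_cos_ln v) ltac:(lra)).
  assert (Ts := is_lim_frac_partial_sums (sin_ln v) sigma (bounded_weight_sin_ln v) ltac:(lra)).
  assert (Lc := is_lim_mult_power (cos_ln v) sigma Hs (proj1 (bounded_weight_cos_ln v))).
  assert (Ls := is_lim_mult_power (sin_ln v) sigma Hs (proj1 (bounded_weight_sin_ln v))).
  assert (scal : forall (u : nat -> R) (l c : R), is_lim_seq u l -> is_lim_seq (fun n => c * u n) (c * l)).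
  { intros u l c Hu. now apply (is_lim_seq_scal_l u c l). }
  assert (uniq : forall (u w : nat -> R) (a b : R), (forall n, u (S n) = w n) ->
     is_lim_seq u a -> is_lim_seq w b -> a = b).
  { intros u w a b E Hu Hw. apply (is_lim_seq_incr_1 u) in Hu.
    apply (is_lim_seq_ext _ _ _ E) in Hu. apply is_lim_seq_unique in Hu, Hw.
    rewrite Hu in Hw. now injection Hw. }
  split.
  - apply (uniq (partial_zeta_re sigma v) _ _ _ (partial_zeta_re_eq sigma v)).
    + replace ((1 - sigma) * zr + v * zi) with ((1 - sigma) * zr - v * (- zi) - 0) by ring.
      repeat apply is_lim_seq_minus'; auto.
    + apply is_lim_seq_minus'; [apply is_lim_seq_const|]. apply is_lim_seq_plus'; auto.
  - apply (uniq (partial_zeta_im sigma v) _ _ _ (partial_zeta_im_eq sigma v)).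
    + replace ((1 - sigma) * zi - v * zr) with (- (1 - sigma) * (- zi) - v * zr + 0) by ring.
      apply is_lim_seq_plus'; [apply is_lim_seq_minus'; auto|exact Ls].
    + apply is_lim_seq_minus'; [apply is_lim_seq_const|]. apply is_lim_seq_minus'; auto.
Qed.

(** * Zeta on the critical line *)

(** Convergence at r / 2 bounds the terms there by M. For |h| < r / 4 the ratio q = |h| / (r / 2) is
    at most 1/2, so M q^n <= 2 M (q^n - q^(n+1)) and the tails telescope. *)
Lemma jet_of_power_series (f : R -> R) (x : R) (a : nat -> R) (r : R) : 0 < r ->
  (forall h, Rabs h < r -> is_series (fun k => a k * h ^ k) (f (x + h))) -> jet f x.
Proof.
  intros Hr H.
  assert (Hb : exists M, 0 < M /\ forall k, Rabs (a k * (r / 2) ^ k) <= M).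
  { apply maj_by_pos. exists 0. apply is_lim_seq_Reals, ex_series_lim_0.
    eexists. apply H. rewrite Rabs_pos_eq; lra. }
  destruct Hb as [M [HM Hb]].
  exists a, (2 * M), (r / 4). split; [lra|]. intros K h Hh.
  specialize (H h ltac:(lra)).
  pose (q := Rabs h / (r / 2)).
  assert (Hq : 0 <= q <= / 2).
  { assert (H2 := ratio_bounds h (r / 4) Hh).
    replace (Rabs h / (r / 4)) with (2 * q) in H2 by (unfold q; field; lra). lra. }
  assert (Hu : forall n, Rabs (a n * h ^ n) <= 2 * M * (q ^ n - q ^ S n)).
  { intros n. specialize (Hb n).
    replace (Rabs (a n * h ^ n)) with (Rabs (a n * (r / 2) ^ n) * q ^ n).
    - assert (0 <= q ^ n) by (apply pow_le; lra). simpl.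
      assert (Rabs (a n * (r / 2) ^ n) * q ^ n <= M * q ^ n) by (apply Rmult_le_compat_r; lra).
      assert (0 <= M * q ^ n * (1 - 2 * q)) by (apply Rmult_le_pos; [apply Rmult_le_pos|]; lra). lra.
    - unfold q, Rdiv. rewrite !Rabs_mult, <- !RPow_abs, !Rpow_mult_distr, (Rabs_pos_eq (r * / 2)) by lra.
      rewrite pow_inv, Rpow_mult_distr. field. split; apply pow_nonzero; lra. }
  assert (Hq0 : is_lim_seq (fun n => q ^ n) 0) by (apply is_lim_seq_geom; rewrite Rabs_pos_eq; lra).
  destruct (series_telescoping_bound _ _ _ Hq0 Hu) as [_ [_ Ht]].
  specialize (Ht K). rewrite (is_series_unique _ _ H) in Ht. eapply Rle_trans; [exact Ht|].
  apply Rmult_le_compat_l; [lra|]. apply pow_incr.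
  replace (Rabs h / (r / 4)) with (2 * q) by (unfold q; field; lra). lra.
Qed.

Lemma jet_continuous (f : R -> R) (x : R) : jet f x -> continuous f x.
Proof.
  intros [a [C [rho [Hr H]]]]. assert (HC := jet_const_nonneg _ _ _ _ _ Hr H).
  assert (H0 : f x = a O).
  { specialize (H O 0). rewrite Rabs_R0, Rplus_0_r in H. specialize (H Hr).
    unfold poly_sum in H. simpl in H. unfold Rdiv in H. rewrite Rmult_0_l, Rmult_0_l, Rmult_0_r in H.
    assert (E : Rabs (f x - a O * 1) = 0) by (apply Rle_antisym; [exact H|apply Rabs_pos]).
    apply Rabs_eq_0 in E. lra. }
  apply filterlim_locally. intros [e He].
  assert (Hd : 0 < Rmin rho (e * rho / (C + 1))).
  { apply Rmin_pos; [easy|]. apply Rdiv_lt_0_compat; nra. }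
  exists (mkposreal _ Hd). intros y Hy. 
  change (Rabs (y - x) < Rmin rho (e * rho / (C + 1))) in Hy. change (Rabs (f y - f x) < e).
  set (h := y - x) in *. replace y with (x + h) by (unfold h; ring).
  assert (Hh : Rabs h < rho) by (eapply Rlt_le_trans; [exact Hy|apply Rmin_l]).
  assert (Hh2 : Rabs h < e * rho / (C + 1)) by (eapply Rlt_le_trans; [exact Hy|apply Rmin_r]).
  specialize (H O h Hh). unfold poly_sum in H. simpl in H. rewrite !Rmult_1_r, <- H0 in H.
  eapply Rle_lt_trans; [exact H|].
  assert (E : Rabs h / rho < e / (C + 1)).
  { apply Rmult_lt_reg_r with rho; [easy|]. unfold Rdiv at 1. rewrite Rmult_assoc, Rinv_l, Rmult_1_r by lra.
    replace (e / (C + 1) * rho) with (e * rho / (C + 1)) by (field; lra). easy. }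
  assert (E2 : e / (C + 1) * (C + 1) = e) by (field; lra).
  assert (0 <= Rabs h / rho) by apply (ratio_bounds h rho Hh). nra.
Qed.

Lemma is_series_C_components (u : nat -> C) (l : C) :
  @is_series C_AbsRing C_NormedModule u l ->
  is_series (fun n => Re (u n)) (Re l) /\ is_series (fun n => Im (u n)) (Im l).
Proof.
  intros H. split.
  - apply (filterlim_ext (fun n => fst (@sum_n C_NormedModule u n))).
    + intros n. induction n as [|n IH]; [now rewrite !sum_O|]. rewrite !sum_Sn, <- IH. easy.
    + refine (filterlim_comp _ _ _ (@sum_n C_NormedModule u) fst _ _ _ H _).
      intros P [e He]. exists e. intros y [Hy _]. now apply He.
  - apply (filterlim_ext (fun n => snd (@sum_n C_NormedModule u n))).
    + intros n. induction n as [|n IH]; [now rewrite !sum_O|]. rewrite !sum_Sn, <- IH. easy.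
    + refine (filterlim_comp _ _ _ (@sum_n C_NormedModule u) snd _ _ _ H _).
      intros P [e He]. exists e. intros y [_ Hy]. now apply He.
Qed.

Lemma pow_n_C_scaled (e : C) (h : R) (k : nat) :
  @pow_n C_AbsRing (e * RtoC h)%C k = (@pow_n C_AbsRing e k * RtoC (h ^ k))%C.
Proof.
  induction k as [|k IH]; simpl pow_n.
  - change (RtoC 1 = RtoC 1 * RtoC (h ^ 0))%C. simpl. ring.
  - rewrite IH. unfold mult; simpl. rewrite RtoC_mult. ring.
Qed.

(** Restriction to the real line through s in the direction e, with e^k absorbed into the
    coefficients. The direction 1 serves the continuation in sigma, the direction i the continuity
    in v. *)
Lemma analytic_at_jets (f : C -> C) (s e : C) (x : R) (g : R -> C) : Cmod e = 1 ->
  (forall h, g (x + h) = f (s + e * RtoC h)%C) -> analytic_at f s ->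
  jet (fun y => Re (g y)) x /\ jet (fun y => Im (g y)) x.
Proof.
  intros He Hg [a [r [Hr H]]].
  assert (Hs : forall h, Rabs h < r ->
     is_series (fun k => Re (@pow_n C_AbsRing e k * a k)%C * h ^ k) (Re (g (x + h))) /\
     is_series (fun k => Im (@pow_n C_AbsRing e k * a k)%C * h ^ k) (Im (g (x + h)))).
  { intros h Hh. rewrite Hg.
    specialize (H (s + e * RtoC h)%C).
    replace (s + e * RtoC h - s)%C with (e * RtoC h)%C in H by ring.
    rewrite Cmod_mult, He, Rmult_1_l, Cmod_R in H. specialize (H Hh).
    destruct (is_series_C_components _ _ H) as [H1 H2].
    split; [eapply is_series_ext; [|exact H1]|eapply is_series_ext; [|exact H2]];
      intros k; cbv beta; rewrite pow_n_C_scaled; unfold scal; simpl; unfold mult; simpl; ring_in_R. }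
  split; eapply jet_of_power_series; try exact Hr; intros h Hh; apply (Hs h Hh).
Qed.

Lemma inv_Rpow_C (x sigma v : R) :
  (/ Rpow_C x (sigma, v))%C = (cos_power sigma v x, - sin_power sigma v x).
Proof.
  unfold Rpow_C, Cexp, cos_power, sin_power, Cinv, Cmult, RtoC. simpl.
  rewrite !Rmult_0_r, Rminus_0_r, Rplus_0_l. rewrite exp_Ropp.
  set (E := exp (sigma * ln x)). set (A := v * ln x).
  assert (HE : 0 < E) by apply exp_pos.
  assert (HA : cos A * cos A + sin A * sin A = 1) by (pose proof (sin2_cos2 A); unfold Rsqr in *; lra).
  replace (E * cos A * (E * cos A * 1) + E * sin A * (E * sin A * 1)) with (E * E)
    by (transitivity (E * E * (cos A * cos A + sin A * sin A)); [rewrite HA; ring|ring]).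
  f_equal; field; lra.
Qed.

Lemma zeta_continuation (zeta : C -> C) (v sigma : R) : is_Riemann_zeta zeta -> v <> 0 -> 0 < sigma ->
  (1 - sigma) * Re (zeta (sigma, v)) + v * Im (zeta (sigma, v))
    = - sigma - (quad_re sigma v * frac_series (cos_ln v) sigma
                 + quad_im sigma v * frac_series (sin_ln v) sigma)
  /\ (1 - sigma) * Im (zeta (sigma, v)) - v * Re (zeta (sigma, v))
    = - v - (quad_im sigma v * frac_series (cos_ln v) sigma
             - quad_re sigma v * frac_series (sin_ln v) sigma).
Proof.
  intros [Hd Ha] Hv Hs.
  pose (zr := fun x => Re (zeta (x, v))). pose (zi := fun x => Im (zeta (x, v))).
  pose (tc := frac_series (cos_ln v)). pose (ts := frac_series (sin_ln v)).
  assert (Hz : forall x, jet zr x /\ jet zi x).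
  { intros x. apply (analytic_at_jets zeta (x, v) (RtoC 1) x (fun y => zeta (y, v))).
    - apply Cmod_1.
    - intros h. f_equal. unfold Cplus, Cmult, RtoC; simpl. f_equal; ring.
    - apply Ha. intros E. apply Hv. now injection E. }
  assert (Ht : forall x, 0 < x -> jet tc x /\ jet ts x).
  { intros x Hx. split; apply jet_frac_series; auto using bounded_weight_cos_ln, bounded_weight_sin_ln. }
  assert (Hdir : forall x, 1 < x ->
    (1 - x) * zr x + v * zi x = - x - (quad_re x v * tc x + quad_im x v * ts x)
    /\ (1 - x) * zi x - v * zr x = - v - (quad_im x v * tc x - quad_re x v * ts x)).
  { intros x Hx.
    destruct (is_series_C_components _ _ (Hd (x, v) Hx)) as [H1 H2].
    apply dirichlet_formula; [easy| |]; apply is_series_R_iff.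
    - eapply is_series_ext; [|exact H1]. intros n. cbv beta. now rewrite inv_Rpow_C.
    - eapply is_series_ext; [|exact H2]. intros n. cbv beta. now rewrite inv_Rpow_C. }
  (* The difference of the two sides, with the polynomials in x spelled out as repeated factors x,
     so that the closure lemmas for jets apply by syntax alone. *)
  pose (D1 := fun x => zr x - x * zr x + v * zi x + x * 1
     + (x * tc x - x * (x * tc x) + v ^ 2 * tc x + (v * ts x + (-2 * v) * (x * ts x)))).
  pose (D2 := fun x => zi x - x * zi x - v * zr x + v
     + (v * tc x + (-2 * v) * (x * tc x) - (x * ts x - x * (x * ts x) + v ^ 2 * ts x))).
  assert (Z1 : forall x, 0 < x -> D1 x = 0).
  { refine (identity_theorem D1 _ _).
    - intros x Hx. destruct (Hz x), (Ht x Hx). unfold D1.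
      repeat first [apply jet_minus | apply jet_plus | apply jet_mult_id | apply jet_const | assumption | apply jet_scal].
    - intros x Hx. destruct (Hdir x Hx) as [E _]. unfold quad_re, quad_im in E. unfold D1.
      lra. }
  assert (Z2 : forall x, 0 < x -> D2 x = 0).
  { refine (identity_theorem D2 _ _).
    - intros x Hx. destruct (Hz x), (Ht x Hx). unfold D2.
      repeat first [apply jet_minus | apply jet_plus | apply jet_mult_id | apply jet_const | assumption | apply jet_scal].
    - intros x Hx. destruct (Hdir x Hx) as [_ E]. unfold quad_re, quad_im in E. unfold D2.
      lra. }
  specialize (Z1 sigma Hs). specialize (Z2 sigma Hs). unfold D1, D2 in *.
  fold tc ts. fold (zr sigma) (zi sigma). unfold quad_re, quad_im. split; lra.
Qed.

(** The real part of sum_(n <= N + 2) n^(-s) - (N + 2)^(1-s) / (1 - s) at s = 1/2 + iv; the shift is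
    the one in [partial_zeta_re_eq]. *)
Definition zeta_approx (v : R) (N : nat) : R :=
  sum_f_R0 (fun k => cos_power (/ 2) v (INR (S k))) (S N)
  - re_power_primitive (ln (INR (S (S N)))) v.

Lemma zeta_half_line_approx (zeta : C -> C) (v : R) (N : nat) : is_Riemann_zeta zeta -> 0 < v ->
  Rabs (Re (zeta (/ 2, v)) - zeta_approx v N) <= (/ 2 + v) * (2 * power_seq (/ 2) (S N)).
Proof.
  intros Hz Hv.
  destruct (zeta_continuation zeta v (/ 2) Hz ltac:(lra) ltac:(lra)) as [E1 E2].
  pose proof (partial_zeta_re_eq (/ 2) v N) as P1. pose proof (partial_zeta_im_eq (/ 2) v N) as P2.
  assert (T1 := frac_series_tail (cos_ln v) (/ 2) N (bounded_weight_cos_ln v) ltac:(lra)).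
  assert (T2 := frac_series_tail (sin_ln v) (/ 2) N (bounded_weight_sin_ln v) ltac:(lra)).
  unfold partial_zeta_re, partial_zeta_im, quad_re, quad_im in *. unfold zeta_approx.
  set (zr := Re (zeta (/ 2, v))) in *. set (zi := Im (zeta (/ 2, v))) in *.
  set (tc := frac_series (cos_ln v) (/ 2)) in *. set (ts := frac_series (sin_ln v) (/ 2)) in *.
  set (tcN := sum_f_R0 (frac_integral (cos_ln v) (/ 2)) N) in *.
  set (tsN := sum_f_R0 (frac_integral (sin_ln v) (/ 2)) N) in *.
  set (xr := sum_f_R0 (fun k => cos_power (/ 2) v (INR (S k))) (S N)) in *.
  set (xi := sum_f_R0 (fun k => sin_power (/ 2) v (INR (S k))) (S N)) in *.
  pose proof (INR_S_ge_1 (S N)) as Hn.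
  assert (Hq := quarter_plus_sqr_pos v).
  assert (ER : re_power_primitive (ln (INR (S (S N)))) v
    = (/ 2 * (INR (S (S N)) * cos_power (/ 2) v (INR (S (S N))))
       + v * (INR (S (S N)) * sin_power (/ 2) v (INR (S (S N))))) / (/ 4 + v ^ 2)).
  { unfold re_power_primitive, cos_power, sin_power. set (n := INR (S (S N))) in *.
    replace (exp (ln n / 2)) with (n * exp (- (/ 2 * ln n))).
    - field. simpl in *. lra.
    - rewrite <- (exp_ln n) at 1 by lra. rewrite <- exp_plus. f_equal. field. }
  set (y1 := INR (S (S N)) * cos_power (/ 2) v (INR (S (S N)))) in *.
  set (y2 := INR (S (S N)) * sin_power (/ 2) v (INR (S (S N)))) in *.
  assert (EZ : zr - (xr - re_power_primitive (ln (INR (S (S N)))) v)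
    = - (/ 2 * (tc - tcN) + v * (ts - tsN))).
  { rewrite ER. apply Rmult_eq_reg_r with (/ 4 + v ^ 2); [|lra].
    replace ((zr - (xr - (/ 2 * y1 + v * y2) / (/ 4 + v ^ 2))) * (/ 4 + v ^ 2))
      with ((zr - xr) * (/ 4 + v ^ 2) + (/ 2 * y1 + v * y2)) by (field; simpl in *; lra).
    (* Half the first equation minus v times the second is the real part after multiplication by the
       conjugate of 1 - s; it eliminates [zi], and likewise [xi]. *)
    assert (F1 := f_equal (fun z => / 2 * z) E1). assert (F2 := f_equal (fun z => v * z) E2).
    assert (F3 := f_equal (fun z => / 2 * z) P1). assert (F4 := f_equal (fun z => v * z) P2).
    cbv beta in *. simpl in *. nra. }
  rewrite EZ, Rabs_Ropp. eapply Rle_trans; [apply Rabs_triang|]. rewrite !Rabs_mult.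
  rewrite (Rabs_pos_eq (/ 2)), (Rabs_pos_eq v) by lra.
  replace (1 / / 2) with 2 in * by field.
  set (p := 2 * power_seq (/ 2) (S N)) in *. nra.
Qed.

(** * The integral *)

(** The limit as V -> infinity of the pairing of [zeta_approx v N]: the terms n = 1, ..., N + 2 give
    1 / (n + 1), and the power term gives ln ((N + 2) + 1). *)
Definition harmonic_defect (N : nat) : R :=
  sum_f_R0 (fun k => / INR (S (S k))) (S N) - ln (INR (S (S (S N)))).

Lemma is_RInt_zeta_approx (V : R) (N : nat) :
  is_RInt (fun v => zeta_approx v N / cosh (PI * v)) 0 V
    (sum_f_R0 (fun k => exp (- (/ 2 * ln (INR (S k)))) * sech_cos (ln (INR (S k))) V) (S N)
     - sech_power_primitive (ln (INR (S (S N)))) V).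
Proof.
  assert (Hint : forall f : R -> R, (forall y, continuous f y) -> is_RInt f 0 V (RInt f 0 V)).
  { intros f Hf. apply (@RInt_correct R_CompleteNormedModule).
    now apply ex_RInt_everywhere_continuous. }
  set (t := ln (INR (S (S N)))).
  apply (is_RInt_ext (fun v => minus
     (sum_f_R0 (fun k => exp (- (/ 2 * ln (INR (S k)))) * (cos (v * ln (INR (S k))) / cosh (PI * v))) (S N))
     (re_power_primitive t v / cosh (PI * v)))).
  - intros v _. match goal with |- minus ?a ?b = ?c => change (a - b = c) end.
    unfold zeta_approx. fold t.
    replace (sum_f_R0 (fun k => exp (- (/ 2 * ln (INR (S k)))) * (cos (v * ln (INR (S k))) / cosh (PI * v))) (S N))
      with (/ cosh (PI * v) * sum_f_R0 (fun k => cos_power (/ 2) v (INR (S k))) (S N)).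
    + unfold Rdiv. ring.
    + rewrite scal_sum. apply sum_eq. intros k _. unfold cos_power, Rdiv. ring.
  - apply (@is_RInt_minus R_NormedModule).
    + induction (S N) as [|K IH].
      * apply (is_RInt_scal (V := R_NormedModule)). apply Hint. intros; apply continuous_sech_cos_integrand.
      * apply (@is_RInt_plus R_NormedModule); [exact IH|].
        apply (is_RInt_scal (V := R_NormedModule)). apply Hint. intros; apply continuous_sech_cos_integrand.
    + apply Hint. intros; apply continuous_re_power_primitive.
Qed.

(** Each of the N + 2 Dirichlet terms contributes an error of at most exp (- PI V), the power term
    at most 2 sqrt (N + 2) times as much. *)
Lemma zeta_approx_integral (V : R) (N : nat) : 0 <= V ->
  Rabs (RInt (fun v => zeta_approx v N / cosh (PI * v)) 0 V - harmonic_defect N)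
  <= exp (- (PI * V)) * (INR (S (S N)) + 2 * exp (ln (INR (S (S N))) / 2)).
Proof.
  intros HV. rewrite (is_RInt_unique _ _ _ _ (is_RInt_zeta_approx V N)). unfold harmonic_defect.
  pose proof (INR_S_ge_1 (S N)).
  set (t := ln (INR (S (S N)))).
  assert (Et : INR (S (S (S N))) = 1 + exp t) by (unfold t; rewrite exp_ln, (S_INR (S (S N))); lra).
  rewrite Et.
  assert (A := sech_power_primitive_near_ln t V HV).
  assert (B : forall K, Rabs (sum_f_R0 (fun k => exp (- (/ 2 * ln (INR (S k)))) * sech_cos (ln (INR (S k))) V) K
     - sum_f_R0 (fun k => / INR (S (S k))) K) <= exp (- (PI * V)) * INR (S K)).
  { assert (term : forall k, Rabs (exp (- (/ 2 * ln (INR (S k)))) * sech_cos (ln (INR (S k))) V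
        - / INR (S (S k))) <= exp (- (PI * V))).
    { intros k. pose proof (INR_S_ge_1 k). pose proof (ln_INR_S_nonneg k).
      set (u := ln (INR (S k))) in *.
      (* With n = exp u this is n^(-1/2) / (n^(1/2) + n^(-1/2)) = 1 / (n + 1). *)
      assert (E : / INR (S (S k)) = exp (- (/ 2 * u)) * / (2 * cosh (u / 2))).
      { rewrite (S_INR (S k)). rewrite <- (exp_ln (INR (S k))) by lra. fold u.
        replace (/ 2 * u) with (u / 2) by field.
        replace (exp u) with (exp (u / 2) * exp (u / 2)) by (rewrite <- exp_plus; f_equal; field).
        unfold cosh. rewrite exp_Ropp. pose proof (exp_pos (u / 2)). field. split; nra. }
      rewrite E, <- Rmult_minus_distr_l, Rabs_mult, Rabs_pos_eq by (left; apply exp_pos).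
      pose proof (sech_cos_near_sech u V HV).
      assert (exp (- (/ 2 * u)) <= 1) by (rewrite <- exp_0; apply exp_le; lra).
      pose proof (exp_pos (- (/ 2 * u))). pose proof (Rabs_pos (sech_cos u V - / (2 * cosh (u / 2)))).
      nra. }
    induction K as [|K IH].
    - specialize (term O). simpl in term |- *. lra.
    - rewrite !tech5. specialize (term (S K)).
      apply Rle_trans with (exp (- (PI * V)) * INR (S K) + exp (- (PI * V)));
        [|rewrite (S_INR (S K)); lra].
      match goal with |- Rabs (?a + ?b - (?c + ?d)) <= _ =>
        replace (a + b - (c + d)) with ((a - c) + (b - d)) by ring end.
      eapply Rle_trans; [apply Rabs_triang|]. lra. }
  specialize (B (S N)).
  match goal with |- Rabs (?a - ?b - (?c - ?d)) <= _ =>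
    replace (a - b - (c - d)) with ((a - c) - (b - d)) by ring end.
  eapply Rle_trans; [apply Rabs_triang|]. rewrite Rabs_Ropp. lra.
Qed.

Definition critical_integrand (zeta : C -> C) (v : R) : R := Re (zeta (/ 2, v)) / cosh (PI * v).

Lemma continuous_critical_integrand (zeta : C -> C) (v : R) : is_Riemann_zeta zeta ->
  continuous (critical_integrand zeta) v.
Proof.
  intros [_ Ha].
  apply (continuous_mult (fun v => Re (zeta (/ 2, v))) (fun v => / cosh (PI * v))).
  - apply jet_continuous.
    apply (analytic_at_jets zeta (/ 2, v) Ci v (fun y => zeta (/ 2, y))).
    + unfold Cmod, Ci; simpl. rewrite Rmult_0_l, Rplus_0_l, !Rmult_1_r. apply sqrt_1.
    + intros h. f_equal. unfold Cplus, Cmult, Ci, RtoC; simpl. f_equal; ring.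
    + apply Ha. intros E. injection E. intros; lra.
  - apply (@ex_derive_continuous R_AbsRing R_NormedModule). auto_derive. apply Rgt_not_eq, cosh_pos.
Qed.

Lemma continuous_zeta_approx (v : R) (N : nat) :
  continuous (fun v => zeta_approx v N / cosh (PI * v)) v.
Proof.
  apply (@ex_derive_continuous R_AbsRing R_NormedModule).
  pose proof (cosh_pos (PI * v)).
  apply (ex_derive_mult (fun v => zeta_approx v N) (fun v => / cosh (PI * v)));
    [|auto_derive; lra].
  unfold zeta_approx.
  apply (@ex_derive_minus R_AbsRing R_NormedModule).
  - eexists. apply (is_derive_sum_f_R0 (fun k v => cos_power (/ 2) v (INR (S k)))
      (fun k v => exp (- (/ 2 * ln (INR (S k)))) * (ln (INR (S k)) * - sin (v * ln (INR (S k)))))).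
    intros k. unfold cos_power. set (u := ln (INR (S k))). auto_derive; [easy|]. ring.
  - unfold re_power_primitive. pose proof (quarter_plus_sqr_pos v).
    auto_derive. simpl in *; lra.
Qed.

(** The linear growth in v is absorbed by the weight: PI > 3 gives 1 / cosh (PI v) <= 2 exp (- 2 v)
    exp (- v), and (1/2 + v) exp (- v) <= 1. The majorant 4 p exp (- 2 v) has integral at most 2 p
    for every V. *)
Lemma critical_integral_approx (zeta : C -> C) (V : R) (N : nat) : is_Riemann_zeta zeta -> 0 <= V ->
  Rabs (RInt (critical_integrand zeta) 0 V - RInt (fun v => zeta_approx v N / cosh (PI * v)) 0 V)
  <= 2 * power_seq (/ 2) (S N).
Proof.
  intros Hz HV. set (p := power_seq (/ 2) (S N)). assert (Hp : 0 < p) by apply exp_pos.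
  assert (Hc1 := fun v => continuous_critical_integrand zeta v Hz).
  assert (Hc2 := fun v => continuous_zeta_approx v N).
  assert (Hc : forall v, continuous (fun v => minus (critical_integrand zeta v) (zeta_approx v N / cosh (PI * v))) v).
  { intros v. apply (continuous_minus (critical_integrand zeta)); auto. }
  match goal with |- Rabs (?a - ?b) <= _ => change (a - b) with (minus a b) end.
  rewrite <- (@RInt_minus R_CompleteNormedModule) by now apply ex_RInt_everywhere_continuous.
  assert (Hg : is_RInt (fun v => 4 * p * exp (- (2 * v))) 0 V
     (minus (- (2 * p * exp (- (2 * V)))) (- (2 * p * exp (- (2 * 0)))))).
  { apply (is_RInt_derive (fun v => - (2 * p * exp (- (2 * v))))).
    - intros v _. auto_derive; [easy|]. ring.
    - intros v _. apply (@ex_derive_continuous R_AbsRing R_NormedModule). auto_derive. easy. }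
  eapply Rle_trans; [apply abs_RInt_le; [easy|now apply ex_RInt_everywhere_continuous]|].
  apply Rle_trans with (RInt (fun v => 4 * p * exp (- (2 * v))) 0 V).
  - apply RInt_le; [easy| |eexists; exact Hg|].
    + apply (ex_RInt_norm (fun v => minus (critical_integrand zeta v) (zeta_approx v N / cosh (PI * v)))).
      now apply ex_RInt_everywhere_continuous.
    (* The comparison takes place on the open interval, which supplies the v > 0 that
       [zeta_half_line_approx] requires. *)
    + intros v Hv. unfold minus, plus, opp; simpl. unfold critical_integrand.
      match goal with |- Rabs ?x <= _ => replace x with ((Re (zeta (/ 2, v)) - zeta_approx v N) / cosh (PI * v))
        by (unfold Rdiv, Re; ring) end.
      rewrite Rabs_div_cosh.
      assert (H1 := zeta_half_line_approx zeta v N Hz ltac:(lra)). fold p in H1.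
      assert (H2 := inv_cosh_le (PI * v)).
      assert (H3 : 0 < / cosh (PI * v)) by apply Rinv_0_lt_compat, cosh_pos.
      assert (H4 : exp (- (PI * v)) <= exp (- (2 * v)) * exp (- v)).
      { rewrite <- exp_plus. apply exp_le. pose proof PI2_3_2. nra. }
      assert (H5 : (/ 2 + v) * exp (- v) <= 1).
      { apply Rmult_le_reg_r with (exp v); [apply exp_pos|].
        rewrite Rmult_assoc, <- exp_plus, Rplus_opp_l, exp_0.
        pose proof (exp_ineq1_le v). lra. }
      assert (H6 := exp_pos (- (2 * v))). assert (H7 := Rabs_pos (Re (zeta (/ 2, v)) - zeta_approx v N)).
      set (z := Rabs _) in *. unfold Rdiv.
      apply Rle_trans with ((/ 2 + v) * (2 * p) * (2 * (exp (- (2 * v)) * exp (- v)))).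
      * apply Rmult_le_compat; lra.
      * replace ((/ 2 + v) * (2 * p) * (2 * (exp (- (2 * v)) * exp (- v))))
          with (4 * p * exp (- (2 * v)) * ((/ 2 + v) * exp (- v))) by ring.
        rewrite <- (Rmult_1_r (4 * p * exp (- (2 * v)))) at 2.
        apply Rmult_le_compat_l; [|easy]. apply Rmult_le_pos; lra.
  - rewrite (is_RInt_unique _ _ _ _ Hg). unfold minus, plus, opp; simpl.
    rewrite Rmult_0_r, Ropp_0, exp_0. pose proof (exp_pos (- (2 * V))). nra.
Qed.

Lemma critical_integral_near_defect (zeta : C -> C) (V : R) (N : nat) : is_Riemann_zeta zeta -> 0 <= V ->
  Rabs (RInt (critical_integrand zeta) 0 V - harmonic_defect N)
  <= 2 * power_seq (/ 2) (S N)
     + exp (- (PI * V)) * (INR (S (S N)) + 2 * exp (ln (INR (S (S N))) / 2)).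
Proof.
  intros Hz HV.
  assert (H1 := critical_integral_approx zeta V N Hz HV).
  assert (H2 := zeta_approx_integral V N HV).
  match goal with |- Rabs (?a - ?c) <= _ =>
    replace (a - c) with ((a - RInt (fun v => zeta_approx v N / cosh (PI * v)) 0 V)
       + (RInt (fun v => zeta_approx v N / cosh (PI * v)) 0 V - c)) by ring end.
  eapply Rle_trans; [apply Rabs_triang|]. lra.
Qed.

Lemma is_lim_critical_tail (c A : R) :
  is_lim (fun V => A + exp (- (PI * V)) * c) p_infty A.
Proof.
  replace (Finite A) with (Finite (A + 0 * c)) by (f_equal; ring).
  apply is_lim_plus'; [apply is_lim_const|].
  apply (is_lim_scal_r _ c p_infty 0). apply is_lim_exp_neg_mult, PI_RGT_0.
Qed.

(* Both defects approximate the same truncated integral as V grows. *)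
Lemma harmonic_defect_cauchy (zeta : C -> C) (N M : nat) : is_Riemann_zeta zeta ->
  Rabs (harmonic_defect N - harmonic_defect M)
  <= 2 * power_seq (/ 2) (S N) + 2 * power_seq (/ 2) (S M).
Proof.
  intros Hz.
  pose (c := fun K => INR (S (S K)) + 2 * exp (ln (INR (S (S K))) / 2)).
  assert (L := is_lim_plus' _ _ _ _ _ (is_lim_critical_tail (c N) (2 * power_seq (/ 2) (S N)))
    (is_lim_critical_tail (c M) (2 * power_seq (/ 2) (S M)))).
  refine (is_lim_le_loc (fun _ => Rabs (harmonic_defect N - harmonic_defect M)) _ p_infty
    (Rabs (harmonic_defect N - harmonic_defect M))
    (2 * power_seq (/ 2) (S N) + 2 * power_seq (/ 2) (S M)) _ (is_lim_const _ _) L).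
  exists 0. intros V HV.
  assert (H1 := critical_integral_near_defect zeta V N Hz ltac:(lra)).
  assert (H2 := critical_integral_near_defect zeta V M Hz ltac:(lra)).
  set (I := RInt (critical_integrand zeta) 0 V) in *.
  replace (harmonic_defect N - harmonic_defect M)
    with (- (I - harmonic_defect N) + (I - harmonic_defect M)) by ring.
  eapply Rle_trans; [apply Rabs_triang|]. rewrite Rabs_Ropp. unfold c. lra.
Qed.

Lemma is_lim_power_half (c : R) : is_lim_seq (fun N => c * power_seq (/ 2) (S N)) 0.
Proof.
  replace (Finite 0) with (Rbar_mult c 0) by (simpl; now rewrite Rmult_0_r).
  apply is_lim_seq_scal_l, (is_lim_seq_incr_1 (power_seq (/ 2))), is_lim_power_seq. lra.
Qed.

Lemma harmonic_defect_eq (N : nat) :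
  harmonic_defect N
  = sum_n_m (fun k => / INR k) 1 (N + 3) - ln (INR (N + 3)) - 1.
Proof.
  replace (N + 3)%nat with (S (S (S N))) by lia.
  rewrite <- (sum_n_m_S (fun k => / INR k) 0 (S (S N))).
  change (sum_n_m (fun n => / INR (S n)) 0 (S (S N))) with (sum_n (fun n => / INR (S n)) (S (S N))).
  rewrite sum_n_Reals, (decomp_sum _ (S (S N))) by lia. unfold harmonic_defect.
  rewrite INR_1. simpl Nat.pred. field.
Qed.

(** [Lim_seq] has a value even for a divergent sequence, so convergence must come before any use of
    [Euler_gamma]. It follows from the Cauchy bound obtained through the integral; the index shift
    by 3 then identifies the limit. *)
Lemma is_lim_harmonic_defect (zeta : C -> C) : is_Riemann_zeta zeta ->
  is_lim_seq harmonic_defect (Euler_gamma - 1).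
Proof.
  intros Hz.
  assert (Hex : ex_finite_lim_seq harmonic_defect).
  { apply ex_lim_seq_cauchy_corr. intros eps.
    destruct (proj2 (is_lim_seq_spec _ _) (is_lim_power_half 2) (pos_div_2 eps)) as [K HK].
    exists K. intros n m Hn Hm.
    assert (H1 := HK n Hn). assert (H2 := HK m Hm). simpl in H1, H2.
    rewrite Rminus_0_r in H1, H2.
    apply Rabs_def2 in H1. apply Rabs_def2 in H2.
    eapply Rle_lt_trans; [apply (harmonic_defect_cauchy zeta n m Hz)|]. lra. }
  destruct Hex as [l Hl].
  assert (E : Euler_gamma = l + 1).
  { unfold Euler_gamma.
    assert (L : is_lim_seq (fun n => sum_n_m (fun k => / INR k) 1 n - ln (INR n)) (l + 1)).
    { apply (is_lim_seq_incr_n _ 3). 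
      apply (is_lim_seq_ext (fun N => harmonic_defect N + 1)).
      - intros N. rewrite harmonic_defect_eq. ring.
      - apply is_lim_seq_plus'; [exact Hl|apply is_lim_seq_const]. }
    now rewrite (is_lim_seq_unique _ _ L). }
  rewrite E. now replace (l + 1 - 1) with l by ring.
Qed.

Theorem mainTheorem8 (zeta : C -> C) (Hzeta : is_Riemann_zeta zeta) :
  is_RInt_gen
    (fun v : R => Re (zeta (RtoC (1 / 2) + Ci * RtoC v)%C) / cosh (PI * v))
    (at_point 0) (Rbar_locally p_infty)
    (Euler_gamma - 1).
Proof.
  set (L := Euler_gamma - 1).
  assert (Hlim : is_lim (RInt (critical_integrand zeta) 0) p_infty L).
  { apply is_lim_spec. intros eps.
    assert (He := cond_pos eps).
    destruct (proj2 (is_lim_seq_spec _ _) (is_lim_power_half 2) (pos_div_2 (pos_div_2 eps))) as [K1 H1].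
    destruct (proj2 (is_lim_seq_spec _ _) (is_lim_harmonic_defect zeta Hzeta) (pos_div_2 (pos_div_2 eps)))
      as [K2 H2].
    (* N is fixed before V because [c] depends on it. Three errors below eps / 4 result:
       approximation of zeta, distance of the defect from its limit, and truncation at V. *)
    pose (N := max K1 K2).
    specialize (H1 N ltac:(lia)). specialize (H2 N ltac:(lia)). fold L in H2. simpl in H1, H2.
    rewrite Rminus_0_r in H1. apply Rabs_def2 in H1.
    pose (c := INR (S (S N)) + 2 * exp (ln (INR (S (S N))) / 2)).
    destruct (proj2 (is_lim_spec _ _ _) (is_lim_critical_tail c 0) (pos_div_2 (pos_div_2 eps))) as [V0 H3].
    exists (Rmax V0 0). intros V HV.
    assert (V0 < V) by (eapply Rle_lt_trans; [apply Rmax_l|exact HV]).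
    assert (0 < V) by (eapply Rle_lt_trans; [apply Rmax_r|exact HV]).
    specialize (H3 V ltac:(easy)). simpl in H3. rewrite Rminus_0_r, Rplus_0_l in H3. apply Rabs_def2 in H3.
    assert (H4 := critical_integral_near_defect zeta V N Hzeta ltac:(lra)). fold c in H4.
    replace (RInt (critical_integrand zeta) 0 V - L)
      with ((RInt (critical_integrand zeta) 0 V - harmonic_defect N) + (harmonic_defect N - L)) by ring.
    eapply Rle_lt_trans; [apply Rabs_triang|]. lra. }
  intros P HP. destruct (Hlim P HP) as [V0 HV0].
  (* The lower endpoint is exactly 0, so the generalised integral reduces to the limit in the upper
     endpoint. *)
  apply (Filter_prod _ _ _ (fun a => a = 0) (fun b => V0 < b)); [easy|now exists V0|].
  intros a b -> Hb. exists (RInt (critical_integrand zeta) 0 b). split; [|now apply HV0].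
  apply (is_RInt_ext (critical_integrand zeta)).
  - intros v _. unfold critical_integrand. do 3 f_equal.
    unfold Cplus, Cmult, Ci, RtoC; simpl. f_equal; field.
  - apply (@RInt_correct R_CompleteNormedModule), ex_RInt_everywhere_continuous.
    intros; now apply continuous_critical_integrand.
Qed.
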